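(* Let $a,b\ge 1$ be integers, $m=a+b$, and $\alpha\in[0,1]$. For each $N\ge1$ let $Z_t^N$ be the total fraction of red balls at time $t$ in the interacting urn model with $N$ urns and parameter $\alpha$, and set $$W_t^N:=\sqrt N\left(Z_t^N-\frac am\right),\qquad t\ge 0.$$ Let $(x_t^\infty)_{t\ge0}$ be defined by $x_0^\infty=0$ and $$x^\infty_{t+1}=x^\infty_t-\frac{2\alpha}{t+m+1}x^\infty_t+\frac{2\alpha-1}{(t+m+1)^2}x^\infty_t+\frac{1}{(t+m+1)^2}\left(\frac am-\frac{a^2}{m^2}\right).$$ Then $$\sigma_t^2:=\frac{1}{(t+m+1)^2}\left(\left[\frac am-\frac{a^2}{m^2}\right]-(1-\alpha)^2x_t^\infty\right)\ge 0\quad\text{for all } t\ge 0,$$ and the stochastic process $\{W_t^N: t\ge0\}$ converges weakly, as $N\to+\infty$, to the Gauss–Markov process $\{W_t:t\ge 0\}$ that solves the recursion $$W_{t+1}=W_t+\sigma_tB_{t+1}\quad(t\ge0),\qquad W_0=0,$$ where $\sigma_t=\sqrt{\sigma_t^2}$ and $\{B_t: t\ge1\}$ is a sequence of i.i.d. $\mathcal N(0,1)$ random variables.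
   Context: Interacting urn model. Let $a,b\ge 1$ be integers (initial numbers of red and white balls in each urn), $m=a+b$, $N\ge 1$ the number of urns, and $\alpha\in[0,1]$. Let $\{U(t,i): t,i\in\mathbb{N}\}$ be i.i.d. random variables uniform on $[0,1]$ (the same family is used for all $N$), and $\mathcal{F}_t=\sigma(U(s,i): 0\le s\le t,\ i\in\mathbb{N})$. For $i=1,\dots,N$ set $X^N_0(i)=a$, $Z^N_0(i)=a/m$, and for $t\ge 0$ $$Z^N_t=\frac1N\sum_{j=1}^N Z^N_t(j),\qquad Y_t(i)=\mathbf{1}_{\{U(t+1,i)\le \alpha Z^N_t+(1-\alpha)Z^N_t(i)\}},$$ $$X^N_{t+1}(i)=X^N_t(i)+Y_t(i),\qquad Z^N_{t+1}(i)=\frac{X^N_{t+1}(i)}{t+1+m}=\frac{t+m}{t+m+1}Z^N_t(i)+\frac{1}{t+m+1}Y_t(i).$$ Thus $X^N_t(i)$ and $Z^N_t(i)$ are the number and fraction of red balls in urn $i$ at time $t$, and $Z^N_t$ is the total fraction of red balls. Time $t$ is discrete, $t\in\{0,1,2,\dots\}$; weak convergence of processes is weak convergence of laws on the space of real sequences with the product topology (equivalently, weak convergence of all finite-dimensional distributions). *)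

(* Defs.v *)
From HB Require Import structures.
From mathcomp Require Import all_boot all_order all_algebra finmap.
From mathcomp Require Import all_classical all_reals all_analysis measurable_realfun.

Set Implicit Arguments.
Unset Strict Implicit.
Unset Printing Implicit Defensive.

Import Order.TTheory GRing.Theory Num.Theory.
Import numFieldNormedType.Exports.

Local Open Scope classical_set_scope.
Local Open Scope ring_scope.

Section probability_notions.
Context {R : realType} {d : measure_display} {T : measurableType d}.
Variable P : probability T R.

Definition mutually_independent (I : choiceType) (X : I -> {RV P >-> R}) :=
  forall (J : {fset I}) (A : I -> set R), (forall i, measurable (A i)) ->
    P (\bigcap_(i in [set` J]) (X i @^-1` A i)) =
    (\prod_(i <- J) P (X i @^-1` A i))%E.

Definition has_law (X : T -> R) (mu : set R -> \bar R) :=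
  forall A : set R, measurable A -> pushforward P X A = mu A.

(** N(m, s^2). The case [s = 0] is separate because [normal_prob m 0] is the
    uniform law on [0, 1] in the library. *)
Definition normal_law (m s : R) (A : set R) : \bar R :=
  if s == 0 then dirac m A else normal_prob m s A.

Definition gaussian_process (W : nat -> {RV P >-> R}) :=
  forall (n : nat) (c : nat -> R), exists m s : R,
    has_law (fun w => \sum_(k < n) c k * W k w) (normal_law m s).

Definition history (W : nat -> {RV P >-> R}) (t : nat) : set (set T) :=
  <<s [set C | exists k : nat, exists2 A : set R,
         (k <= t)%N /\ measurable A & C = W k @^-1` A] >>.

(** For every Borel set [A], some function [g (W t)] of the present is a version
    of the conditional probability of [W t.+1 \in A] given [W 0], ..., [W t]. *)
Definition markov_process (W : nat -> {RV P >-> R}) :=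
  forall (t : nat) (A : set R), measurable A ->
    exists g : R -> R, [/\ measurable_fun setT g,
      forall x, 0 <= g x <= 1 &
      forall C, history W t C ->
        P ((W t.+1 @^-1` A) `&` C) = (\int[P]_(w in C) (g (W t w))%:E)%E].

End probability_notions.

Arguments mutually_independent {R d T} P {I} X.
Arguments gaussian_process {R d T} P W.
Arguments markov_process {R d T} P W.

(** Weak convergence of the laws on the space of real sequences with the product
    topology: expectations of bounded continuous functionals converge. *)
Definition converges_weakly (R : realType) (d d' : measure_display)
    (T : measurableType d) (T' : measurableType d')
    (P : probability T R) (Q : probability T' R)
    (X : nat -> nat -> {RV P >-> R}) (Y : nat -> {RV Q >-> R}) :=
  forall f : {ptws nat -> R} -> R, continuous f -> bounded_fun f ->
    ('E_P[fun w => f (fun t => X N t w)] @[N --> \oo] -->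
     'E_Q[fun w => f (fun t => Y t w)])%E.

Arguments converges_weakly {R d d' T T'} P Q X Y.

Section urn_model.
Context {R : realType}.
Variables (a b : nat) (alpha : R).

Definition fraction (t x : nat) : R := x%:R / (t + (a + b))%:R.

(** The urns are indexed by [1, ..., N]. *)
Definition average (N : nat) (z : nat -> R) : R :=
  N%:R^-1 * \sum_(1 <= j < N.+1) z j.

(** [red_balls N u t i] is X^N_t(i) when the uniform variables U(s, j) take the
    values [u s j]; the boolean test is the indicator Y_s(i). *)
Fixpoint red_balls (N : nat) (u : nat -> nat -> R) (t : nat) : nat -> nat :=
  if t is s.+1 then fun i =>
    let z j := fraction s (red_balls N u s j) in
    (red_balls N u s i
     + (u s.+1 i <= alpha * average N z + (1 - alpha) * z i)%R)%N
  else fun=> a.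

Definition red_fraction N u t i : R := fraction t (red_balls N u t i).

Definition total_fraction N u t : R := average N (red_fraction N u t).

(** The sequence x^oo_t: the limit, as the number of urns grows, of the variance
    at time [t] of the fraction of red balls in a single urn. *)
Fixpoint limit_variance (t : nat) : R :=
  if t is s.+1 then
    let x := limit_variance s in
    let n : R := (s + (a + b) + 1)%:R in
    x - 2 * alpha / n * x + (2 * alpha - 1) / n ^+ 2 * x
      + 1 / n ^+ 2 * (a%:R / (a + b)%:R - a%:R ^+ 2 / (a + b)%:R ^+ 2)
  else 0.

Definition sigma2 (t : nat) : R :=
  1 / (t + (a + b) + 1)%:R ^+ 2 *
  ((a%:R / (a + b)%:R - a%:R ^+ 2 / (a + b)%:R ^+ 2)
   - (1 - alpha) ^+ 2 * limit_variance t).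

End urn_model.

Definition fluctuation (R : realType) (d : measure_display)
    (T : measurableType d) (P : probability T R) (a b : nat) (alpha : R)
    (U : nat -> nat -> {RV P >-> R}) (N t : nat) (w : T) : R :=
  Num.sqrt N%:R *
  (total_fraction a b alpha N (fun s i => U s i w) t - a%:R / (a + b)%:R).

Section fluctuation_measurable.
Context (R : realType) (d : measure_display) (T : measurableType d).
Context (P : probability T R) (a b : nat) (alpha : R).
Context (U : nat -> nat -> {RV P >-> R}) (N : nat).

Let u (w : T) (s i : nat) : R := U s i w.

Lemma measurable_average (z : T -> nat -> R) :
  (forall i, measurable_fun setT (z ^~ i)) ->
  measurable_fun setT (fun w => average N (z w)).
Proof.
move=> mz; apply: measurable_funM; first exact: measurable_cst.
exact: measurable_sum.
Qed.

Lemma measurable_red_fraction t i :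
  measurable_fun setT (fun w => red_fraction a b alpha N (u w) t i).
Proof.
apply: measurable_funM; last exact: measurable_cst.
elim: t i => [|t IH] i; first exact: measurable_cst.
under eq_fun do rewrite /= natrD.
apply: measurable_funD => //.
have mz j : measurable_fun setT
    (fun w => fraction a b t (red_balls a b alpha N (u w) t j) : R).
  by apply: measurable_funM => //; exact: measurable_cst.
have mb : measurable_fun setT (fun w => u w t.+1 i <=
    alpha * average N (fun j => fraction a b t (red_balls a b alpha N (u w) t j))
    + (1 - alpha) * fraction a b t (red_balls a b alpha N (u w) t i)).
  apply: measurable_fun_ler; first exact: measurable_funP.
  apply: measurable_funD; apply: measurable_funM => //; try exact: measurable_cst.
  exact: (@measurable_average
    (fun w j => fraction a b t (red_balls a b alpha N (u w) t j))).
have : measurable_fun setT (fun w => if u w t.+1 i <=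
    alpha * average N (fun j => fraction a b t (red_balls a b alpha N (u w) t j))
    + (1 - alpha) * fraction a b t (red_balls a b alpha N (u w) t i)
    then 1 else 0 : R).
  by apply: measurable_fun_ifT => //; exact: measurable_cst.
by apply: eq_measurable_fun => w _; case: ifP.
Qed.

Lemma measurable_fluctuation t :
  measurable_fun setT (fluctuation a b alpha U N t).
Proof.
apply: measurable_funM; first exact: measurable_cst.
apply: measurable_funB; last exact: measurable_cst.
apply: (@measurable_average (fun w => red_fraction a b alpha N (u w) t)) => i.
exact: measurable_red_fraction.
Qed.

HB.instance Definition _ t := isMeasurableFun.Build _ _ _ _
  (fluctuation a b alpha U N t) (measurable_fluctuation t).

End fluctuation_measurable.

(* Main.v *)
From HB Require Import structures.
Require Import Defs.
From mathcomp Require Import all_boot all_order all_algebra finmap.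
From mathcomp Require Import all_classical all_reals all_analysis measurable_realfun.
From mathcomp Require Import ring lra.

Set Implicit Arguments.
Unset Strict Implicit.
Unset Printing Implicit Defensive.

Import Order.TTheory GRing.Theory Num.Theory.
Import numFieldNormedType.Exports.

Local Open Scope classical_set_scope.
Local Open Scope ring_scope.

(** Write [q] for [a / (a + b)] and [Z] for the total fraction. Given the past,
    the draws of a round are independent Bernoulli variables whose parameters
    average to [Z]. So [Z] is a martingale, and an increment of the fluctuation
    is a centred sum of [N] independent terms of size [1 / sqrt N]; given the
    past it is nearly Gaussian, and its variance ([round_variance]) is a
    polynomial in the mean and the mean square of the urn fractions. Up to noise
    of order [1 / sqrt N], these two averages follow a deterministic recursion
    solved by [q] and [limit_variance t + q ^ 2]. Hence the conditional variance
    is close to the constant [sigma2 t]. Increments with asymptotically constant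
    conditional variances are asymptotically independent, and the limit process
    is the sequence of partial sums of their Gaussian limits.

    Estimates on the urns. Only finitely many histories of draws are possible up
    to a given time, so the expectation of a function of the history is a finite
    recursive average, [hist_avg] ([expectation_draws]). For these averages,
    [deviation_avg] is the law of large numbers above and [lindeberg] is a
    central limit theorem with rate, obtained by exchanging one Bernoulli
    variable at a time for a Gaussian one with the same variance. The exchange
    can be iterated because averaging over Gaussian noise is a semigroup
    ([gauss_avgD]) that preserves Taylor estimates ([smooth_gauss_avg]). Together
    they give [increments_prod_avg]: the expectation of a product of smooth functions
    of the single increments differs by [O(1 / sqrt N)] from the product of their
    Gaussian averages.

    From products to functionals. A continuous function of a sequence is close,
    uniformly on a product of compact intervals, to a combination of products of
    smooth bumps of single coordinates ([near_insensitive], [grid_approx_dist]).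
    Second moments confine all the increments to such a box up to a small
    probability, uniformly in [N]. Hence convergence on products implies weak
    convergence ([product_tests_cvg]); the fluctuations are the image of their
    increments under the continuous map [partial_sums].

    The limit process. The noise [B t.+1] is independent of the sigma-algebra of
    the earlier noises, so it can be integrated out while they are kept frozen
    ([freezing]). This gives the Markov property, with a Gaussian transition
    kernel, and, one noise at a time, the Gaussian law of every linear
    combination. Finally [sigma2] is nonnegative because [limit_variance] stays
    below [q - q ^ 2] ([limit_variance_bound]). *)

(** * Gaussian laws on the line *)

Section gaussian_law.
Context {R : realType}.
Local Notation mu := (@lebesgue_measure R).
Local Notation N01 := (@normal_prob R 0 1).

Lemma measurable_affine (m s : R) :
  measurable_fun setT (fun x : measurableTypeR R => m + s * x : measurableTypeR R).
Proof. by apply: measurable_funD => //; apply: measurable_funM. Qed.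

(** Two measures that agree on the half-open intervals are equal. *)
Lemma lebesgue_measure_affine (m s : R) (A : set (measurableTypeR R)) : 0 < s ->
  measurable A ->
  mu A = (s%:E * pushforward mu (fun x => (m + s * x)%R : measurableTypeR R) A)%E.
Proof.
move=> s0 mA.
have m_phi := @measurable_affine m s.
pose nu : {measure set (measurableTypeR R) -> \bar R} :=
  mscale (NngNum (ltW s0)) (pushforward mu (fun x => m + s * x : measurableTypeR R)).
rewrite -[RHS]/(nu m_phi A).
apply: lebesgue_measure_unique => // _ [[x y] _ <-] /=.
rewrite /mscale /= /pushforward.
rewrite (_ : _ @^-1` _ = `](x - m) / s, (y - m) / s]%classic); last first.
  apply/seteqP; split => z /=; rewrite !in_itv /= ltr_pdivrMr// ler_pdivlMr//;
  rewrite ltrBlDr lerBrDr ![z * s]mulrC ![_ + m]addrC //.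
rewrite !lebesgue_measure_itv/= !lte_fin ltr_pM2r ?invr_gt0// ltrD2r.
case: ifP => _; last by rewrite mule0.
by rewrite -!EFinD -EFinM; congr EFin; field; rewrite gt_eqF.
Qed.

(** The Radon-Nikodym derivative of [normal_prob m s] is identified almost
    everywhere with [normal_pdf m s], because both have the same integrals over
    measurable sets. *)
Lemma ge0_integral_normal_prob (m s : R) (f : R -> \bar R) :
  measurable_fun setT f -> (forall x, 0 <= f x)%E ->
  (\int[normal_prob m s]_x f x = \int[mu]_x (f x * (normal_pdf m s x)%:E))%E.
Proof.
move=> mf f0.
have dom := normal_prob_dominates m s.
rewrite -(Radon_Nikodym_SigmaFinite.change_of_variables dom)//=.
have mRN := Radon_Nikodym_SigmaFinite.f_integrable dom.
have mpdf : measurable_fun setT (fun x => (normal_pdf m s x)%:E).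
  by apply/measurable_EFinP; exact: measurable_normal_pdf.
apply: ae_eq_integral => //.
- by apply: emeasurable_funM => //; exact: measurable_int mRN.
- exact: emeasurable_funM.
- apply: ae_eqe_mul2l => /=.
  apply: integral_ae_eq => //=.
  by move=> E _ mE; rewrite -Radon_Nikodym_SigmaFinite.f_integral.
Qed.

Lemma normal_pdf_affine (m s x : R) : 0 < s ->
  normal_pdf 0 1 x = s * normal_pdf m s (m + s * x).
Proof.
move=> s0; have sn0 : s != 0 by rewrite gt_eqF.
rewrite !normal_pdfE ?oner_eq0// mulrA; congr (_ * _).
  rewrite /normal_peak -!mulrnAr !(sqrtrM _ (sqr_ge0 _)) !sqrtr_sqr normr1.
  by rewrite gtr0_norm// mul1r invfM mulrA divff// mul1r.
rewrite /normal_fun; congr expR.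
by field; rewrite ?sn0//.
Qed.

Lemma normal_prob_affine (m s : R) (A : set R) : 0 < s -> measurable A ->
  N01 ((fun x => m + s * x) @^-1` A) = normal_prob m s A.
Proof.
move=> s0 mA; have maff := @measurable_affine m s.
rewrite {1}/normal_prob.
under eq_integral do rewrite (normal_pdf_affine m _ s0) EFinM.
have mpdf : measurable_fun setT (fun x => (normal_pdf m s x)%:E).
  by apply/measurable_EFinP; exact: measurable_normal_pdf.
have mA' : measurable ((fun x => m + s * x) @^-1` A).
  by rewrite -[X in measurable X]setTI; exact: maff.
rewrite ge0_integralZl//; last 3 first.
- apply: measurable_funTS.
  by apply: (measurable_comp measurableT _ mpdf maff).
- by move=> x _; rewrite lee_fin normal_pdf_ge0.
- by rewrite lee_fin ltW.
have -> : (\int[mu]_(x in (fun x : R => (m + s * x)%R) @^-1` A)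
    (normal_pdf m s (m + s * x))%:E =
   \int[pushforward mu (fun x : R => (m + s * x)%R : measurableTypeR R)]_(x in A) (normal_pdf m s x)%:E)%E.
  rewrite ge0_integral_pushforward//; first exact: measurable_funTS.
  by move=> x _; rewrite lee_fin normal_pdf_ge0.
pose nu : {measure set (measurableTypeR R) -> \bar R} :=
  mscale (NngNum (ltW s0)) (pushforward mu (fun x : R => (m + s * x)%R : measurableTypeR R)).
transitivity (\int[nu maff]_(x in A) (normal_pdf m s x)%:E)%E.
  rewrite ge0_integral_mscale//; first exact: measurable_funTS.
  by move=> x _; rewrite lee_fin normal_pdf_ge0.
apply: eq_measure_integral => B mB BA.
exact/esym/lebesgue_measure_affine.
Qed.

(** Completing the square: the density of a sum [y] times the conditional
    density of its first term [x] given that sum. The factor in which [x]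
    remains is again a Gaussian density, so [x] can be integrated out. *)
Lemma normal_pdf_mul (s e r x y : R) : 0 < s -> 0 < e -> 0 < r ->
  r ^+ 2 = s ^+ 2 + e ^+ 2 ->
  normal_pdf 0 s x * normal_pdf x e y =
  normal_pdf 0 r y * normal_pdf (s ^+ 2 * y / r ^+ 2) (s * e / r) x.
Proof.
move=> s0 e0 r0 rE.
have [sn0 en0 rn0] : [/\ s != 0, e != 0 & r != 0] by rewrite !gt_eqF.
have ser : s * e / r != 0 by rewrite !mulf_neq0// invr_eq0.
rewrite !normal_pdfE// mulrACA [RHS]mulrACA; congr (_ * _).
  rewrite /normal_peak -!invfM; congr (_^-1).
  rewrite -!mulrnAr !(sqrtrM _ (sqr_ge0 _)) !sqrtr_sqr.
  rewrite !gtr0_norm// ?divr_gt0// ?mulr_gt0//.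
  by field.
rewrite /normal_fun -!expRD; congr expR.
have rn02 : s ^+ 2 + e ^+ 2 != 0 by rewrite -rE expf_neq0.
by rewrite expr_div_n exprMn rE; field; rewrite rn02 sn0 en0.
Qed.

Lemma normal_prob_conv (s e r : R) (A : set R) : 0 < s -> 0 < e -> 0 < r ->
  r ^+ 2 = s ^+ 2 + e ^+ 2 -> measurable A ->
  (\int[normal_prob 0 s]_x (normal_prob x e A) = normal_prob 0 r A)%E.
Proof.
move=> s0 e0 r0 rE mA.
have sn0 : s != 0 by rewrite gt_eqF.
have en0 : e != 0 by rewrite gt_eqF.
have mpdf2 : measurable_fun setT
    (fun p : measurableTypeR R * measurableTypeR R => normal_pdf p.1 e p.2).
  rewrite (_ : (fun _ => _) = fun p => normal_peak e *
      expR (- (p.2 - p.1) ^+ 2 / (e ^+ 2 *+ 2))); last first.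
    by apply/funext => p; rewrite normal_pdfE.
  apply: measurable_funM => //; apply: measurableT_comp => //.
  apply: measurable_funM => //; apply: measurableT_comp => //.
  by apply: measurable_funX; apply: measurable_funB.
pose K (p : measurableTypeR R * measurableTypeR R) : \bar R :=
  (normal_pdf p.1 e p.2 * \1_A p.2)%:E.
have mK : measurable_fun setT K.
  apply/measurable_EFinP/measurable_funM => //.
  exact: measurableT_comp.
have K0 p : (0 <= K p)%E by rewrite lee_fin mulr_ge0// normal_pdf_ge0.
have KE x : normal_prob x e A = (\int[mu]_y K (x, y))%E.
  rewrite /normal_prob integral_mkcond; apply: eq_integral => y _ /=.
  by rewrite /K /= patchE indicE; case: ifP => _; rewrite ?mulr1// mulr0.
have mpdf m t : measurable_fun setT (fun x : measurableTypeR R => (normal_pdf m t x)%:E).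
  by apply/measurable_EFinP; exact: measurable_normal_pdf.
under eq_integral do rewrite KE.
rewrite ge0_integral_normal_prob; last 2 first.
- have := measurable_fun_fubini_tonelli_F (m2 := mu) K mK K0.
  by rewrite /fubini_F.
- by move=> x; apply: integral_ge0.
have mL : measurable_fun setT (fun p : measurableTypeR R * measurableTypeR R =>
    (K p * (normal_pdf 0 s p.1)%:E)%E).
  apply: emeasurable_funM => //; apply: measurableT_comp (mpdf 0 s) _.
  exact: measurable_fst.
have L0 (p : measurableTypeR R * measurableTypeR R) :
    (0 <= K p * (normal_pdf 0 s p.1)%:E)%E.
  by rewrite mule_ge0// lee_fin normal_pdf_ge0.
transitivity (\int[mu]_x \int[mu]_y (K (x, y) * (normal_pdf 0 s x)%:E))%E.
  apply: eq_integral => x _; rewrite ge0_integralZr//.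
  - exact: measurableT_comp mK _.
  - by rewrite lee_fin normal_pdf_ge0.
rewrite (fubini_tonelli _ mL L0)/=.
rewrite {1}/normal_prob [RHS]integral_mkcond; apply: eq_integral => y _ /=.
rewrite patchE.
transitivity (\int[mu]_x ((normal_pdf 0 r y * \1_A y)%:E *
  (normal_pdf (s ^+ 2 * y / r ^+ 2) (s * e / r) x)%:E))%E.
  apply: eq_integral => x _; rewrite /K /= -!EFinM; congr EFin.
  by rewrite mulrAC [X in X * _]mulrC (normal_pdf_mul _ _ s0 e0 r0 rE) mulrAC.
rewrite ge0_integralZl//; last 2 first.
- by move=> x _; rewrite lee_fin normal_pdf_ge0.
- by rewrite lee_fin mulr_ge0// normal_pdf_ge0.
rewrite integral_normal_pdf mule1 indicE.
by case: ifP => _; rewrite ?mulr1// mulr0.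
Qed.

End gaussian_law.

(** * Moments of the standard Gaussian law *)

Section gaussian_moments.
Context {R : realType}.
Local Notation mu := (@lebesgue_measure R).
Local Notation N01 := (@normal_prob R 0 1).

Lemma integrable_mulr d (T : measurableType d) (P : {measure set T -> \bar R})
    (c : R) (f : T -> R) : P.-integrable setT (EFin \o f) ->
  P.-integrable setT (EFin \o (fun x => c * f x)).
Proof. by move=> fi; apply: eq_integrable (integrableZl measurableT c fi). Qed.

Lemma integrable_addr d (T : measurableType d) (P : {measure set T -> \bar R})
    (f g : T -> R) : P.-integrable setT (EFin \o f) ->
  P.-integrable setT (EFin \o g) ->
  P.-integrable setT (EFin \o (fun x => f x + g x)).
Proof.
by move=> fi gi; apply: eq_integrable (integrableD measurableT fi gi).
Qed.

(** Tilting the standard density by [expR (h * z)] recentres it at [h]. *)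
Lemma normal_prob_expR (h : R) :
  (\int[N01]_z (expR (h * z))%:E = (expR (h ^+ 2 / 2))%:E)%E.
Proof.
rewrite ge0_integral_normal_prob; last 2 first.
  by apply/measurable_EFinP/measurableT_comp => //; exact: measurable_funM.
  by move=> x; rewrite lee_fin expR_ge0.
transitivity (\int[mu]_z ((expR (h ^+ 2 / 2))%:E * (normal_pdf h 1 z)%:E))%E.
  apply: eq_integral => z _; rewrite -!EFinM; congr EFin.
  rewrite !normal_pdfE ?oner_eq0// mulrCA [RHS]mulrCA; congr (_ * _).
  by rewrite /normal_fun -!expRD; congr expR; field.
rewrite ge0_integralZl//.
- by rewrite integral_normal_pdf mule1.
- by apply/measurable_EFinP; exact: measurable_normal_pdf.
- by move=> z _; rewrite lee_fin normal_pdf_ge0.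
Qed.

(** Tilting the standard density by this exponential changes its standard
    deviation from 1 to [s]. *)
Lemma normal_prob_expRN_sqr (s : R) : 0 < s ->
  (\int[N01]_z (expR (- ((s ^-2 - 1) / 2) * z ^+ 2))%:E = s%:E)%E.
Proof.
move=> s0; have sn0 : s != 0 by rewrite gt_eqF.
rewrite ge0_integral_normal_prob; last 2 first.
- apply/measurable_EFinP/measurableT_comp => //; apply: measurable_funM => //.
- by move=> x; rewrite lee_fin expR_ge0.
transitivity (\int[mu]_z (s%:E * (normal_pdf 0 s z)%:E))%E.
  apply: eq_integral => z _; rewrite -!EFinM; congr EFin.
  rewrite !normal_pdfE ?oner_eq0// mulrCA [RHS]mulrA; congr (_ * _).
    rewrite /normal_peak -!mulrnAr !(sqrtrM _ (sqr_ge0 _)) !sqrtr_sqr normr1.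
    by rewrite gtr0_norm// mul1r invfM mulrA divff// mul1r.
  by rewrite /normal_fun -!expRD; congr expR; field; rewrite sn0.
rewrite ge0_integralZl//.
- by rewrite integral_normal_pdf mule1.
- by apply/measurable_EFinP; exact: measurable_normal_pdf.
- by move=> z _; rewrite lee_fin normal_pdf_ge0.
- by rewrite lee_fin ltW.
Qed.

Lemma integrable_ge0_bounded_by d (T : measurableType d) (P : {measure set T -> \bar R})
    (f : T -> R) (M : R) : measurable_fun setT f -> (forall x, 0 <= f x) ->
  (\int[P]_x (f x)%:E = M%:E)%E -> P.-integrable setT (EFin \o f).
Proof.
move=> mf f0 fM; apply/integrableP; split; first exact/measurable_EFinP.
under eq_integral do rewrite gee0_abs ?lee_fin//=.
by rewrite fM ltry.
Qed.

Lemma integrable_expR_normal (h : R) :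
  (N01).-integrable setT (EFin \o (fun z => expR (h * z))).
Proof.
apply: (integrable_ge0_bounded_by _ _ (normal_prob_expR h)).
- by apply: measurableT_comp => //; exact: measurable_funM.
- by move=> x; exact: expR_ge0.
Qed.

(** Exponential moments dominate powers, through [1 + y <= expR y] at
    [y = |z| / n.+1] raised to the power [n.+1]. *)
Lemma integrable_normr_expn_normal (n : nat) :
  (N01).-integrable setT (EFin \o (fun z : R => `|z| ^+ n.+1)).
Proof.
pose b (z : R) := (n.+1%:R ^+ n.+1) * (expR (1 * z) + expR (-1 * z)).
have ib : (N01).-integrable setT (EFin \o b).
  apply: integrable_mulr.
  by apply: integrable_addr; exact: integrable_expR_normal.
apply: (le_integrable measurableT _ _ ib).
  apply/measurable_EFinP; apply: measurable_funX; exact: normr_measurable.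
move=> z _ /=; rewrite lee_fin ger0_norm ?exprn_ge0//.
rewrite [leRHS]ger0_norm; last by rewrite mulr_ge0 ?exprn_ge0 ?addr_ge0 ?expR_ge0.
have n0 : 0 < n.+1%:R :> R by rewrite ltr0n.
have -> : `|z| ^+ n.+1 = n.+1%:R ^+ n.+1 * (`|z| / n.+1%:R) ^+ n.+1.
  by rewrite -exprMn mulrCA divff ?mulr1 ?gt_eqF.
rewrite ler_wpM2l ?exprn_ge0//.
apply: (@le_trans _ _ (expR (`|z| / n.+1%:R) ^+ n.+1)).
  rewrite lerXn2r ?nnegrE ?expR_ge0 ?divr_ge0//.
  by rewrite (le_trans _ (expR_ge1Dx _))// lerDr.
rewrite -expRM_natl mulrCA divff ?mulr1 ?gt_eqF// mul1r mulN1r.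
case: (ger0P z) => _; first by rewrite lerDl expR_ge0.
by rewrite lerDr expR_ge0.
Qed.

Lemma integrable_expn_normal (n : nat) :
  (N01).-integrable setT (EFin \o (fun z : R => z ^+ n.+1)).
Proof.
apply: (le_integrable measurableT _ _ (integrable_normr_expn_normal n)).
  by apply/measurable_EFinP; exact: measurable_funX.
by move=> z _ /=; rewrite lee_fin normrX [leRHS]ger0_norm// exprn_ge0.
Qed.

Lemma integrable_cst_prob d (T : measurableType d) (P : probability T R) (c : R) :
  P.-integrable setT (EFin \o (fun=> c)).
Proof. exact: finite_measure_integrable_cst. Qed.

Lemma Rintegral_cst_prob d (T : measurableType d) (P : probability T R) (c : R) :
  \int[P]_x c = c.
Proof. by rewrite Rintegral_cst//= probability_setT/= mulr1. Qed.

(** Integrating [1 + h z <= expR (h z)] gives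
    [h M <= expR (h ^ 2 / 2) - 1 <= h ^ 2] for the mean [M] and small [h] of
    either sign; then [h] tends to 0. *)
Lemma Rintegral_normal_id : \int[N01]_z z = 0.
Proof.
have iz := integrable_expn_normal 0.
have ub h : `|h| <= 1 -> h * \int[N01]_z z <= h ^+ 2.
  move=> h1; have : \int[N01]_z (1 + h * z) <= \int[N01]_z (expR (h * z)).
    apply: le_Rintegral => //.
    - apply: integrable_addr; first exact: integrable_cst_prob.
      exact: integrable_mulr.
    - exact: integrable_expR_normal.
    - by move=> z _; exact: expR_ge1Dx.
  rewrite RintegralD//; last 2 first.
  - exact: integrable_cst_prob.
  - exact: integrable_mulr.
  rewrite Rintegral_cst_prob RintegralZl//.
  rewrite [X in _ <= X]/Rintegral normal_prob_expR/= => H.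
  have h2 : h ^+ 2 <= 1 by rewrite -real_normK ?num_real// exprn_ile1.
  have := expR_ge1Dx (- (h ^+ 2 / 2)); rewrite expRN => H2.
  have e0 := expR_gt0 (h ^+ 2 / 2).
  have : (1 - h ^+ 2 / 2) * expR (h ^+ 2 / 2) <= 1.
    by rewrite -ler_pdivlMr ?div1r.
  have hh := sqr_ge0 h.
  move: H e0 hh h2; set E := expR _; set q := h ^+ 2; set M := Rintegral _ _ _; nra.
apply/eqP; rewrite -normr_le0; apply/ler_addgt0Pl => e e0; rewrite addr0.
pose t := Num.min e 1.
have t0 : 0 < t by rewrite lt_min e0 ltr01.
apply: (@le_trans _ _ t); last by rewrite ge_min lexx.
have t1 : `|t| <= 1 by rewrite gtr0_norm// ge_min lexx orbT.
have := ub t t1; have := ub (- t); rewrite normrN => /(_ t1).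
rewrite expr2 mulrNN mulNr -mulrN ler_pM2l// ler_pM2l// => H1 H2.
by rewrite ler_norml H2 lerNl H1.
Qed.

(** The same method with [1 + l z ^ 2 <= expR (l z ^ 2)] and
    [l = (1 - s ^ -2) / 2], for which the right-hand side integrates to [s];
    then [s] tends to 1 from both sides. *)
Lemma Rintegral_normal_sqr : \int[N01]_z z ^+ 2 = 1.
Proof.
have iz := integrable_expn_normal 1.
set M := Rintegral _ _ _.
have ub s : 0 < s -> 1 - (s ^-2 - 1) / 2 * M <= s.
  move=> s0; pose l := - ((s ^-2 - 1) / 2).
  have : \int[N01]_z (1 + l * z ^+ 2) <= \int[N01]_z (expR (l * z ^+ 2)).
    apply: le_Rintegral => //.
    - apply: integrable_addr; first exact: integrable_cst_prob.
      exact: integrable_mulr.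
    - apply: (integrable_ge0_bounded_by _ _ (normal_prob_expRN_sqr s0)).
      + by apply: measurableT_comp => //; apply: measurable_funM.
      + by move=> x; exact: expR_ge0.
    - by move=> z _; exact: expR_ge1Dx.
  rewrite RintegralD//; last 2 first.
  - exact: integrable_cst_prob.
  - exact: integrable_mulr.
  rewrite Rintegral_cst_prob RintegralZl//.
  by rewrite [X in _ <= X]/Rintegral normal_prob_expRN_sqr//= mulNr.
have ub2 s : 0 < s -> 2 * s ^+ 2 * (1 - s) <= (1 - s) * (1 + s) * M.
  move=> s0; have H := ub s s0.
  have s20 : 0 < s ^+ 2 by rewrite exprn_gt0.
  have E : s ^+ 2 * (1 - (s ^- 2 - 1) / 2 * M) = s ^+ 2 - (1 - s ^+ 2) / 2 * M.
    by field; rewrite gt_eqF.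
  have : s ^+ 2 * (1 - (s ^- 2 - 1) / 2 * M) <= s ^+ 2 * s by rewrite ler_pM2l.
  rewrite E; lra.
apply/eqP; rewrite -subr_eq0 -normr_le0; apply/ler_addgt0Pl => e e0; rewrite addr0.
pose t := Num.min (e / 2) (1 / 2).
have t0 : 0 < t by rewrite lt_min !divr_gt0.
have t1 : t <= 1 / 2 by rewrite ge_min lexx orbT.
have te : 2 * t <= e by rewrite mulrC -ler_pdivlMr// ge_min lexx.
have H1 := ub2 (1 + t) ltac:(lra); have H2 := ub2 (1 - t) ltac:(lra).
have {}H1 : (2 + t) * M <= 2 * (1 + t) ^+ 2.
  rewrite -(ler_pM2l t0); nra.
have {}H2 : 2 * (1 - t) ^+ 2 <= (2 - t) * M.
  rewrite -(ler_pM2l t0); nra.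
have {}H1 : M <= 1 + 2 * t by nra.
have {}H2 : 1 - 2 * t <= M by nra.
rewrite ler_norml; apply/andP; split; lra.
Qed.

End gaussian_moments.

(** * Averaging over Gaussian noise *)

Section gaussian_average.
Context {R : realType}.
Local Notation N01 := (@normal_prob R 0 1).

(** Values between 0 and 1 keep products bounded and make every integral against
    a probability finite. *)
Definition test_function (g : R -> R) :=
  measurable_fun setT g /\ forall x, 0 <= g x <= 1.

(** The heat semigroup at time [v]. Scaling a standard Gaussian, rather than
    integrating against [normal_prob], gives the Dirac mass when [v = 0]. *)
Definition gauss_avg (v : R) (g : R -> R) (x : R) : R :=
  \int[N01]_z g (x + Num.sqrt v * z).

Lemma test_function_integrable d (T : measurableType d) (P : probability T R)
    (f : T -> R) : measurable_fun setT f -> (forall x, 0 <= f x <= 1) ->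
  P.-integrable setT (EFin \o f).
Proof.
move=> mf f01; apply: (le_integrable measurableT _ _ (integrable_cst_prob P 1)).
  exact/measurable_EFinP.
move=> x _ /=; have /andP[f0 f1] := f01 x.
by rewrite lee_fin normr1 ger0_norm.
Qed.

Lemma measurable_test_affine (g : R -> R) (x s : R) : measurable_fun setT g ->
  measurable_fun setT (fun z : R => g (x + s * z)).
Proof. by move=> mg; apply: (measurableT_comp mg); exact: measurable_affine. Qed.

Lemma gauss_avgE v g x : test_function g ->
  (gauss_avg v g x)%:E = (\int[N01]_z (g (x + Num.sqrt v * z))%:E)%E.
Proof.
move=> [mg g01]; rewrite /gauss_avg /Rintegral fineK//.
apply: integrable_fin_num => //.
apply: test_function_integrable => //; exact: measurable_test_affine.
Qed.

Lemma gauss_avg_test v g : test_function g -> test_function (gauss_avg v g).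
Proof.
move=> tg; have [mg g01] := tg; split; last first.
  move=> x; apply/andP; split.
    by apply: Rintegral_ge0 => z _; case/andP: (g01 (x + Num.sqrt v * z)).
  rewrite -[leRHS](Rintegral_cst_prob N01 1); apply: le_Rintegral => //.
  - apply: test_function_integrable => //; exact: measurable_test_affine.
  - exact: integrable_cst_prob.
  - by move=> z _; case/andP: (g01 (x + Num.sqrt v * z)).
apply/measurable_EFinP.
have mG : measurable_fun setT (fun p : measurableTypeR R * measurableTypeR R =>
    (g (p.1 + Num.sqrt v * p.2))%:E).
  apply/measurable_EFinP; apply: (measurableT_comp mg).
  by apply: measurable_funD => //; apply: measurable_funM.
have G0 (p : measurableTypeR R * measurableTypeR R) :
    (0 <= (g (p.1 + (Num.sqrt v * p.2)))%:E)%E.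
  by rewrite lee_fin; case/andP: (g01 (p.1 + Num.sqrt v * p.2)).
have := measurable_fun_fubini_tonelli_F (m2 := N01) _ mG G0.
apply: eq_measurable_fun => x _.
by rewrite /= gauss_avgE.
Qed.

Lemma ge0_integral_normal_affine (m s : R) (f : R -> \bar R) : 0 < s ->
  measurable_fun setT f -> (forall x, 0 <= f x)%E ->
  (\int[N01]_x f (m + s * x)%R = \int[normal_prob m s]_x f x)%E.
Proof.
move=> s0 mf f0; have maff := @measurable_affine R m s.
have H := ge0_integral_pushforward maff N01 measurableT mf (fun y _ => f0 y).
rewrite preimage_setT in H.
apply: etrans (esym H) _.
by apply: eq_measure_integral => B mB _; exact: (normal_prob_affine m s0 mB).
Qed.

(** Positive variances are convolved through their densities; a zero variance
    has no density and is treated apart. *)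
Lemma normal_prob_sum (v w u : R) (A : set R) : 0 <= v -> 0 <= w ->
  measurable A ->
  (\int[N01]_x (N01 [set y | (u + Num.sqrt v * x + Num.sqrt w * y)%R \in A])
   = N01 [set z | (u + Num.sqrt (v + w) * z)%R \in A])%E.
Proof.
move=> v0 w0 mA.
have mpre (x s : R) : measurable [set y : measurableTypeR R | x + s * y \in A].
  rewrite (_ : [set _ | _] = (fun y => x + s * y) @^-1` A); last first.
    by apply/seteqP; split => y /=; rewrite inE.
  rewrite -[X in measurable X]setTI; exact: measurable_affine.
have [v_eq0|vn0] := eqVneq v 0.
  rewrite v_eq0 sqrtr0 add0r; under eq_integral do rewrite mul0r addr0.
  rewrite integral_cst//= [X in (_ * X)%E](@probability_setT _ _ _ N01) mule1.
  by [].
have [w_eq0|wn0] := eqVneq w 0.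
  rewrite w_eq0 sqrtr0 addr0.
  transitivity (\int[N01]_x (\1_[set z : R | u + Num.sqrt v * z \in A] x)%:E)%E.
    apply: eq_integral => x _.
    rewrite indicE.
    have [xA|xA] := pselect (is_true (u + Num.sqrt v * x \in A)).
      rewrite mem_set// (_ : [set y | _] = setT) ?probability_setT//.
      by apply/seteqP; split => y //= _; rewrite mul0r addr0.
    rewrite memNset// (_ : [set y | _] = set0) ?measure0//.
    by apply/seteqP; split => y //=; rewrite mul0r addr0.
  by rewrite integral_indic// setIT.
have {vn0}sv : 0 < Num.sqrt v by rewrite sqrtr_gt0 lt_neqAle eq_sym vn0.
have {wn0}sw : 0 < Num.sqrt w by rewrite sqrtr_gt0 lt_neqAle eq_sym wn0.
have svw : 0 < Num.sqrt (v + w).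
  by rewrite sqrtr_gt0 ltr_wpDr// -sqrtr_gt0.
pose A' := [set z : R | u + z \in A].
have mA' : measurable A'.
  rewrite (_ : A' = [set z : R | u + 1 * z \in A]); first exact: mpre.
  by apply/seteqP; split => y /=; rewrite mul1r.
have -> : N01 [set z | u + Num.sqrt (v + w) * z \in A] =
    normal_prob 0 (Num.sqrt (v + w)) A'.
  rewrite -(normal_prob_affine 0 svw mA'); congr (N01 _).
  by apply/seteqP; split => y /=; rewrite add0r.
rewrite -(normal_prob_conv sv sw svw _ mA'); last by rewrite !sqr_sqrtr// addr_ge0.
have mK : measurable_fun setT (fun x : R => normal_prob x (Num.sqrt w) A').
  have mE : measurable [set p : measurableTypeR R * measurableTypeR R |
      p.1 + Num.sqrt w * p.2 \in A'].
    rewrite (_ : [set _ | _] =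
       (fun p : measurableTypeR R * measurableTypeR R => p.1 + Num.sqrt w * p.2) @^-1` A').
      rewrite -[X in measurable X]setTI.
      by apply: measurable_funD => //; apply: measurable_funM.
    by apply/seteqP; split => y /=; rewrite inE.
  have := measurable_fun_xsection N01 mE.
  apply: eq_measurable_fun => x _ /=.
  rewrite -(normal_prob_affine x sw mA'); congr (N01 _).
  apply/seteqP; split => y; rewrite /xsection /=; first by rewrite inE /= inE.
  by move=> ?; rewrite inE /= inE.
transitivity (\int[N01]_x
   normal_prob (0 + Num.sqrt v * x)%R (Num.sqrt w) A')%E.
  apply: eq_integral => x _; rewrite -(normal_prob_affine _ sw mA'); congr (N01 _).
  by apply/seteqP; split => y; rewrite /A' /= add0r addrA.
apply: (ge0_integral_normal_affine 0 sv mK) => x; exact: measure_ge0.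
Qed.

(** The two averages integrate [g] against the images of a product and of a
    single Gaussian law; these images agree by [normal_prob_sum]. *)
Lemma gauss_avgD v w g x : 0 <= v -> 0 <= w -> test_function g ->
  gauss_avg v (gauss_avg w g) x = gauss_avg (v + w) g x.
Proof.
move=> v0 w0 tg; have [mg g01] := tg; apply: EFin_inj.
rewrite !gauss_avgE//; last exact: gauss_avg_test.
pose psi (p : measurableTypeR R * measurableTypeR R) : measurableTypeR R :=
  x + Num.sqrt v * p.1 + Num.sqrt w * p.2.
have mpsi : measurable_fun setT psi.
  apply: measurable_funD; last by apply: measurable_funM.
  by apply: measurable_funD => //; apply: measurable_funM.
have mEg : measurable_fun setT (EFin \o g) by exact/measurable_EFinP.
have Eg0 y : (0 <= (EFin \o g) y)%E by rewrite lee_fin; case/andP: (g01 y).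
transitivity (\int[N01]_a \int[N01]_b ((EFin \o g) \o psi) (a, b))%E.
  by apply: eq_integral => a _; rewrite gauss_avgE.
rewrite -(fubini_tonelli1 (m1 := N01) (m2 := N01) ((EFin \o g) \o psi)); last 2 first.
- exact: measurableT_comp.
- by move=> p; exact: Eg0.
have maff := @measurable_affine R x (Num.sqrt (v + w)).
rewrite -[LHS](ge0_integral_pushforward mpsi (N01 \x N01)%E measurableT)//.
rewrite -[RHS](ge0_integral_pushforward maff N01 measurableT mEg)//.
apply: eq_measure_integral => B mB _.
transitivity (\int[N01]_a N01 [set b | (x + Num.sqrt v * a + Num.sqrt w * b)%R \in B])%E.
  by apply: eq_integral => a _ /=; congr (N01 _).
rewrite normal_prob_sum//; congr (N01 _).
by apply/seteqP; split => y /=; rewrite inE.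
Qed.

End gaussian_average.

(** * Exchanging Bernoulli noise for Gaussian noise *)

Section lindeberg_method.
Context {R : realType}.
Local Notation N01 := (@normal_prob R 0 1).

(** Here [A] stands for the derivative and [B] for half the second derivative.
    An expansion with a cubic remainder is all that the exchange argument uses,
    and piecewise cubic functions have one at their knots. *)
Definition taylor_at (C : R) (g : R -> R) (x A B : R) :=
  forall h, `|g (x + h) - g x - A * h - B * h ^+ 2| <= C * `|h| ^+ 3.

(** The constant is uniform in the point, and the coefficients depend measurably
    on it so that they can be averaged over noise. *)
Definition smooth (C : R) (g : R -> R) := exists g1 g2 : R -> R,
  [/\ measurable_fun setT g1, measurable_fun setT g2 &
      forall x, taylor_at C g x (g1 x) (g2 x)].

(** Half the difference of the expansions at the steps 1 and -1 isolates [A],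
    and half their sum isolates [B]. *)
Lemma taylor_at_bound C g x A B : (forall y, 0 <= g y <= 1) ->
  taylor_at C g x A B -> `|A| <= 1 + C /\ `|B| <= 1 + C.
Proof.
move=> g01 H; have := H 1; have := H (- 1).
rewrite normrN normr1 !expr1n !mulr1 sqrrN expr1n mulr1 mulrN1.
have /andP[a1 a2] := g01 (x + 1); have /andP[b1 b2] := g01 (x - 1).
have /andP[c1 c2] := g01 x.
by rewrite !ler_norml => /andP[? ?] /andP[? ?]; split; apply/andP; split; lra.
Qed.

Lemma taylor_at_ge0 C g x A B : taylor_at C g x A B -> 0 <= C.
Proof.
by move=> /(_ 1) H; rewrite (le_trans (normr_ge0 _) (le_trans H _))// normr1 expr1n mulr1.
Qed.

(** The expansion passes under the integral sign with the same constant, so the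
    Taylor estimate is preserved by the heat semigroup. *)
Lemma smooth_gauss_avg C g v x : test_function g -> smooth C g ->
  exists A B, taylor_at C (gauss_avg v g) x A B.
Proof.
move=> [mg g01] [g1 [g2 [m1 m2 T]]].
have C0 := taylor_at_ge0 (T x).
pose s := Num.sqrt v.
have mb (f : R -> R) : measurable_fun setT f -> (forall y, `|f y| <= 1 + C) -> forall y,
    (N01).-integrable setT (EFin \o (fun z => f (y + s * z))).
  move=> mf bf y.
  apply: (le_integrable measurableT _ _ (integrable_cst_prob N01 (1 + C))).
    by apply/measurable_EFinP; exact: measurable_test_affine.
  by move=> z _ /=; rewrite lee_fin [leRHS]ger0_norm ?addr_ge0.
have ig y : (N01).-integrable setT (EFin \o (fun z => g (y + s * z))).
  apply: mb => // z; rewrite ger0_norm ?(andP (g01 z)).1//.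
  by rewrite (le_trans (andP (g01 z)).2)// lerDl.
have i1 : (N01).-integrable setT (EFin \o (fun z => g1 (x + s * z))).
  by apply: mb => // z; have [] := taylor_at_bound g01 (T z).
have i2 : (N01).-integrable setT (EFin \o (fun z => g2 (x + s * z))).
  by apply: mb => // z; have [] := taylor_at_bound g01 (T z).
exists (\int[N01]_z g1 (x + s * z)), (\int[N01]_z g2 (x + s * z)) => h.
pose F z := g (x + h + s * z) + (-1 * g (x + s * z) +
  (- h * g1 (x + s * z) + - h ^+ 2 * g2 (x + s * z))).
have iF : (N01).-integrable setT (EFin \o F).
  by apply: integrable_addr => //; apply: integrable_addr; [exact: integrable_mulr|
     apply: integrable_addr; exact: integrable_mulr].
have -> : gauss_avg v g (x + h) - gauss_avg v g x
    - (\int[N01]_z g1 (x + s * z)) * h - (\int[N01]_z g2 (x + s * z)) * h ^+ 2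
    = \int[N01]_z F z.
  rewrite RintegralD//; last first.
    apply: integrable_addr; first exact: integrable_mulr.
    by apply: integrable_addr; exact: integrable_mulr.
  rewrite RintegralD//; last 2 first.
  - exact: integrable_mulr.
  - by apply: integrable_addr; exact: integrable_mulr.
  rewrite RintegralD//; last 2 first.
  - exact: integrable_mulr.
  - exact: integrable_mulr.
  rewrite !RintegralZl// /gauss_avg -/s; ring.
apply: (le_trans (le_normr_Rintegral measurableT iF)).
rewrite -[leRHS](Rintegral_cst_prob N01); apply: le_Rintegral => //.
- by apply: (integrable_norm iF).
- exact: integrable_cst_prob.
- move=> z _; have := T (x + s * z) h; rewrite /F.
  by congr (`|_| <= _); rewrite [x + h + _]addrAC; ring.
Qed.

Definition normal_abs3 : R := \int[N01]_z `|z| ^+ 3.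

Lemma normal_abs3_ge0 : 0 <= normal_abs3.
Proof. by apply: Rintegral_ge0 => z _; rewrite exprn_ge0. Qed.

(** The noise has mean 0 and variance [v], so the Taylor polynomial averages to
    [g x + B * v] and the remainder to a third absolute moment. *)
Lemma gauss_avg_taylor C g x A B v : test_function g -> 0 <= v ->
  taylor_at C g x A B ->
  `|gauss_avg v g x - g x - B * v| <= C * normal_abs3 * (v * Num.sqrt v).
Proof.
move=> [mg g01] v0 T; have C0 := taylor_at_ge0 T.
pose s := Num.sqrt v.
have ig : (N01).-integrable setT (EFin \o (fun z => g (x + s * z))).
  by apply: test_function_integrable => //; exact: measurable_test_affine.
have iz : (N01).-integrable setT (EFin \o (fun z : R => z)) := integrable_expn_normal 0.
have iz2 : (N01).-integrable setT (EFin \o (fun z : R => z ^+ 2)) := integrable_expn_normal 1.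
have iz3 : (N01).-integrable setT (EFin \o (fun z : R => `|z| ^+ 3)) := integrable_normr_expn_normal 2.
pose F z := g (x + s * z) + (- g x + (- (A * s) * z + - (B * v) * z ^+ 2)).
have ic : (N01).-integrable setT (EFin \o (fun=> - g x)) by exact: integrable_cst_prob.
have iF : (N01).-integrable setT (EFin \o F).
  by apply: integrable_addr => //; apply: integrable_addr => //;
     apply: integrable_addr; exact: integrable_mulr.
have -> : gauss_avg v g x - g x - B * v = \int[N01]_z F z.
  rewrite RintegralD//; last first.
    by apply: integrable_addr => //; apply: integrable_addr; exact: integrable_mulr.
  rewrite RintegralD//; last by apply: integrable_addr; exact: integrable_mulr.
  rewrite RintegralD//; last 2 first.
  - exact: integrable_mulr.
  - exact: integrable_mulr.
  rewrite !RintegralZl// Rintegral_normal_id Rintegral_normal_sqr.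
  rewrite Rintegral_cst_prob /gauss_avg -/s; ring.
apply: (le_trans (le_normr_Rintegral measurableT iF)).
have -> : C * normal_abs3 * (v * Num.sqrt v) =
    \int[N01]_z ((C * (v * s)) * `|z| ^+ 3).
  by rewrite RintegralZl// /normal_abs3 -/s; ring.
apply: le_Rintegral => //.
- by apply: (integrable_norm iF).
- exact: integrable_mulr.
- move=> z _; have := T (s * z).
  rewrite normrM (ger0_norm (sqrtr_ge0 v)) !exprMn.
  have -> : Num.sqrt v ^+ 3 = v * s by rewrite exprS sqr_sqrtr// mulrC.
  by rewrite sqr_sqrtr// !mulrA /F; congr (`|_| <= _); ring.
Qed.

(** The expectation of [g] at [x] plus a centred Bernoulli variable of parameter
    [p] scaled by [c]. *)
Definition bern_op (c p : R) (g : R -> R) (x : R) : R :=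
  p * g (x + c * (1 - p)) + (1 - p) * g (x - c * p).

(** A centred Bernoulli variable has variance [p * (1 - p)] and is bounded by 1,
    so the argument is that of [gauss_avg_taylor]. *)
Lemma bern_op_taylor C g x A B c p : 0 <= c -> 0 <= p <= 1 ->
  taylor_at C g x A B ->
  `|bern_op c p g x - g x - B * (c ^+ 2 * (p * (1 - p)))| <= C * c ^+ 3.
Proof.
move=> c0 /andP[p0 p1] T; have C0 := taylor_at_ge0 T.
have q0 : 0 <= 1 - p by rewrite subr_ge0.
pose e1 := g (x + c * (1 - p)) - g x - A * (c * (1 - p)) - B * (c * (1 - p)) ^+ 2.
pose e2 := g (x - c * p) - g x - A * (- (c * p)) - B * (- (c * p)) ^+ 2.
have E : bern_op c p g x - g x - B * (c ^+ 2 * (p * (1 - p))) =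
    p * e1 + (1 - p) * e2 by rewrite /bern_op /e1 /e2; ring.
have bd k : 0 <= k <= 1 -> C * `|c * k| ^+ 3 <= C * c ^+ 3.
  move=> /andP[k0 k1]; rewrite ler_wpM2l// lerXn2r ?nnegrE//.
  by rewrite ger0_norm ?mulr_ge0// ler_piMr.
have h1 : `|e1| <= C * c ^+ 3.
  by apply: le_trans (T _) (bd _ _); rewrite q0 lerBlDr lerDl.
have h2 : `|e2| <= C * c ^+ 3.
  by apply: le_trans (T _) _; rewrite normrN bd// p0.
rewrite E (le_trans (ler_normD _ _))// !normrM (ger0_norm p0) (ger0_norm q0).
have -> : C * c ^+ 3 = p * (C * c ^+ 3) + (1 - p) * (C * c ^+ 3) by ring.
by rewrite lerD// ler_wpM2l.
Qed.

(** Equal first and second moments give equal averages of the Taylor polynomial;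
    only the remainders differ. *)
Lemma bern_op_gauss C g x A B c p : test_function g -> 0 <= c -> 0 <= p <= 1 ->
  taylor_at C g x A B ->
  `|bern_op c p g x - gauss_avg (c ^+ 2 * (p * (1 - p))) g x|
    <= C * (1 + normal_abs3) * c ^+ 3.
Proof.
move=> tg c0 p01 T; have C0 := taylor_at_ge0 T.
have H1 := bern_op_taylor c0 p01 T; have /andP[p0 p1] := p01.
set v := c ^+ 2 * _ in H1 *.
have v0 : 0 <= v by rewrite !mulr_ge0// subr_ge0.
have vc : v <= c ^+ 2.
  rewrite ler_piMr ?sqr_ge0// mulr_ile1 ?subr_ge0//.
  by rewrite lerBlDr lerDl.
have sc : Num.sqrt v <= c.
  by rewrite -[leRHS]ger0_norm// -sqrtr_sqr ler_wsqrtr.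
have H2 := gauss_avg_taylor tg v0 T.
have H3 : C * normal_abs3 * (v * Num.sqrt v) <= C * normal_abs3 * c ^+ 3.
  rewrite ler_wpM2l ?mulr_ge0 ?normal_abs3_ge0//.
  by rewrite exprSr ler_pM ?sqrtr_ge0.
have -> : bern_op c p g x - gauss_avg v g x =
  (bern_op c p g x - g x - B * v) - (gauss_avg v g x - g x - B * v) by ring.
rewrite (le_trans (ler_normB _ _))//; lra.
Qed.

Lemma gauss_avg0 (g : R -> R) x : gauss_avg 0 g x = g x.
Proof.
rewrite /gauss_avg sqrtr0; under eq_Rintegral do rewrite mul0r addr0.
by rewrite Rintegral_cst_prob.
Qed.

(** By the semigroup law, the difference of the variances acts as a short heat
    flow on a function that is as smooth as [g]; its effect is of first order in
    the time. *)
Lemma gauss_avg_lipschitz C g x v w : test_function g -> smooth C g ->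
  0 <= v <= 1 -> 0 <= w <= 1 ->
  `|gauss_avg v g x - gauss_avg w g x| <= (1 + C + C * normal_abs3) * `|v - w|.
Proof.
move=> tg sg; wlog wv : v w / w <= v => [H v01 w01|/andP[v0 v1] /andP[w0 w1]].
  by have [/H|/ltW/H] := leP w v; [exact|rewrite distrC [X in _ * X]distrC; exact].
have tG := gauss_avg_test w tg.
have [A [B T]] := smooth_gauss_avg w x tg sg; have C0 := taylor_at_ge0 T.
have [_ BC] := taylor_at_bound tG.2 T.
have u0 : 0 <= v - w by rewrite subr_ge0.
have <- : gauss_avg (v - w) (gauss_avg w g) x = gauss_avg v g x.
  by rewrite gauss_avgD// subrK.
have H := gauss_avg_taylor tG u0 T.
rewrite (ger0_norm u0).
have s1 : Num.sqrt (v - w) <= 1 by rewrite -sqrtr1 ler_wsqrtr//; lra.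
set G := gauss_avg _ _ _ in H *; set G' := gauss_avg _ _ _ in H *.
have -> : G - G' = (G - G' - B * (v - w)) + B * (v - w) by ring.
rewrite (le_trans (ler_normD _ _))// normrM (ger0_norm u0).
rewrite [leRHS]mulrDl addrC lerD ?ler_wpM2r//.
rewrite (le_trans H)// ler_wpM2l ?mulr_ge0 ?normal_abs3_ge0//.
by rewrite ler_piMr.
Qed.

Definition bern_ops (l : seq (R * R)) (g : R -> R) : R -> R :=
  foldr (fun cp => bern_op cp.1 cp.2) g l.

Lemma bern_op_dist c p g1 g2 e x : 0 <= p <= 1 ->
  (forall y, `|g1 y - g2 y| <= e) -> `|bern_op c p g1 x - bern_op c p g2 x| <= e.
Proof.
move=> /andP[p0 p1] H; have q0 : 0 <= 1 - p by rewrite subr_ge0.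
have -> : bern_op c p g1 x - bern_op c p g2 x =
  p * (g1 (x + c * (1 - p)) - g2 (x + c * (1 - p))) +
  (1 - p) * (g1 (x - c * p) - g2 (x - c * p)) by rewrite /bern_op; ring.
rewrite (le_trans (ler_normD _ _))// !normrM (ger0_norm p0) (ger0_norm q0).
have -> : e = p * e + (1 - p) * e by ring.
by rewrite lerD// ler_wpM2l.
Qed.

(** The bits are exchanged one at a time for Gaussian variables of the same
    variance. The exchanged ones act through [gauss_avg V g], which is as smooth
    as [g], so each exchange costs a multiple of the third power of its
    scale. *)
Lemma lindeberg C g (l : seq (R * R)) x : test_function g -> smooth C g ->
  (forall cp, cp \in l -> 0 <= cp.1 /\ 0 <= cp.2 <= 1) ->
  `|bern_ops l g x
    - gauss_avg (\sum_(cp <- l) cp.1 ^+ 2 * (cp.2 * (1 - cp.2))) g x|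
  <= C * (1 + normal_abs3) * \sum_(cp <- l) cp.1 ^+ 3.
Proof.
move=> tg sg; elim: l x => [|[c p] l IH] x Hl.
  by rewrite !big_nil gauss_avg0 subrr normr0 mulr0.
rewrite !big_cons/=.
have [/= c0 p01] := Hl (c, p) (mem_head _ _).
have {}IH y := IH y (fun cp h => Hl cp (mem_behead (s := (c, p) :: l) h)).
set V := \sum_(cp <- l) _ ^+ 2 * _ in IH *; set S := \sum_(cp <- l) _ in IH *.
have V0 : 0 <= V.
  rewrite /V big_seq; apply: sumr_ge0 => -[c' p'] h.
  have [/= ? /andP[? ?]] := Hl _ (mem_behead (s := (c, p) :: l) h).
  by rewrite !mulr_ge0// subr_ge0.
have v0 : 0 <= c ^+ 2 * (p * (1 - p)).
  by case/andP: p01 => p0 p1; rewrite !mulr_ge0// subr_ge0.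
rewrite -gauss_avgD//.
have [A [B T]] := smooth_gauss_avg V x tg sg.
have H1 := bern_op_gauss (gauss_avg_test V tg) c0 p01 T.
have H2 := bern_op_dist c x p01 IH.
rewrite [leRHS]mulrDr [leRHS]addrC.
by apply: le_trans (ler_distD (bern_op c p (gauss_avg V g) x) _ _) _; exact: lerD.
Qed.

End lindeberg_method.

(** * A smooth step function *)

Section step_function.
Context {R : realType}.

Definition cube_pos (x : R) : R := (Num.max x 0) ^+ 3.

(** A third finite difference of the truncated cube, that is, the primitive of
    the quadratic B-spline: it rises from 0 to 1 on the interval from 0 to 3. *)
Definition smooth_step (x : R) : R :=
  (cube_pos x - 3 * cube_pos (x - 1) + 3 * cube_pos (x - 2) - cube_pos (x - 3)) / 6.

Lemma cube_pos_ge x : 0 <= x -> cube_pos x = x ^+ 3.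
Proof. by move=> x0; rewrite /cube_pos max_l. Qed.

Lemma cube_pos_le x : x <= 0 -> cube_pos x = 0.
Proof. by move=> x0; rewrite /cube_pos max_r// expr0n. Qed.

(** The second derivative is Lipschitz with a corner at 0, so only the case in
    which [x] and [x + h] have different signs is not a polynomial identity. *)
Lemma cube_pos_taylor x :
  taylor_at 1 cube_pos x (3 * (Num.max x 0) ^+ 2) (3 * Num.max x 0).
Proof.
move=> h; rewrite mul1r.
have [x0|x0] := leP 0 x; have [xh0|xh0] := leP 0 (x + h).
- rewrite !cube_pos_ge// (_ : _ - _ = h ^+ 3); last by ring.
  by rewrite normrX.
- rewrite (cube_pos_ge x0) (cube_pos_le (ltW xh0)).
  have h0 : h < 0 by lra.
  rewrite (ltr0_norm h0).
  have -> : 0 - x ^+ 3 - 3 * x ^+ 2 * h - 3 * x * h ^+ 2 = h ^+ 3 - (x + h) ^+ 3.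
    by ring.
  have e1 : h ^+ 3 <= (x + h) ^+ 3.
    have : 0 <= x * (3 * (x + h) ^+ 2 - 3 * x * (x + h) + x ^+ 2).
      by apply: mulr_ge0 => //; have := sqr_ge0 (x + h); have := sqr_ge0 x; nra.
    have -> : (x + h) ^+ 3 = h ^+ 3 + x * (3 * (x + h) ^+ 2 - 3 * x * (x + h) + x ^+ 2).
      by ring.
    by lra.
  have e2 : (x + h) ^+ 3 <= 0 by rewrite exprn_odd_le0// ltW.
  rewrite (_ : (- h) ^+ 3 = - h ^+ 3); last by ring.
  by rewrite ler_norml; apply/andP; split; lra.
- rewrite (cube_pos_le (ltW x0)) cube_pos_ge// !(expr0n, mulr0, mul0r, subr0).
  have h0 : 0 < h by lra.
  by rewrite !ger0_norm ?exprn_ge0 ?(ltW h0)// lerXn2r ?nnegrE ?(ltW h0)//; lra.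
- rewrite (cube_pos_le (ltW x0)) (cube_pos_le (ltW xh0)).
  by rewrite !(expr0n, mulr0, mul0r, subr0) normr0 exprn_ge0.
Qed.

Lemma measurable_max0 : measurable_fun setT (fun x : R => Num.max x 0).
Proof. exact: measurable_maxr. Qed.

Lemma taylor_at_comb C C' g g' x A B A' B' (k k' : R) :
  taylor_at C g x A B -> taylor_at C' g' x A' B' ->
  taylor_at (`|k| * C + `|k'| * C') (fun y => k * g y + k' * g' y) x
    (k * A + k' * A') (k * B + k' * B').
Proof.
move=> T T' h.
rewrite (_ : _ - _ = k * (g (x + h) - g x - A * h - B * h ^+ 2) +
  k' * (g' (x + h) - g' x - A' * h - B' * h ^+ 2)); last by ring.
by rewrite (le_trans (ler_normD _ _))// !normrM mulrDl -!mulrA lerD// ler_wpM2l.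
Qed.

Lemma smooth_comb C C' (g g' : R -> R) (k k' : R) : smooth C g -> smooth C' g' ->
  smooth (`|k| * C + `|k'| * C') (fun y => k * g y + k' * g' y).
Proof.
move=> [g1 [g2 [m1 m2 T]]] [g1' [g2' [m1' m2' T']]].
exists (fun y => k * g1 y + k' * g1' y), (fun y => k * g2 y + k' * g2' y).
split; last by move=> x; exact: taylor_at_comb.
- by apply: measurable_funD; apply: measurable_funM.
- by apply: measurable_funD; apply: measurable_funM.
Qed.

Lemma smooth_affine C (g : R -> R) (k c : R) : smooth C g ->
  smooth (C * `|k| ^+ 3) (fun y => g (c + k * y)).
Proof.
move=> [g1 [g2 [m1 m2 T]]].
exists (fun y => k * g1 (c + k * y)), (fun y => k ^+ 2 * g2 (c + k * y)).
split.
- by apply: measurable_funM => //; exact: measurable_test_affine.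
- by apply: measurable_funM => //; exact: measurable_test_affine.
- move=> x h; have := T (c + k * x) (k * h).
  rewrite normrM; congr (`|_| <= _); last by rewrite exprMn mulrA.
  by rewrite mulrDr addrA; ring.
Qed.

Lemma smooth_cube_pos : smooth 1 cube_pos.
Proof.
exists (fun x => 3 * (Num.max x 0) ^+ 2), (fun x => 3 * Num.max x 0).
have m := measurable_max0.
split; last exact: cube_pos_taylor.
- by apply: measurable_funM => //; exact: measurable_funX.
- exact: measurable_funM.
Qed.

Lemma smooth_step_smooth : exists C, smooth C smooth_step.
Proof.
have S c := smooth_affine 1 c smooth_cube_pos.
have S1 := smooth_comb (1 / 6) (- (1 / 2)) (S 0) (S (- 1)).
have S2 := smooth_comb (1 / 2) (- (1 / 6)) (S (- 2)) (S (- 3)).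
have S3 := smooth_comb 1 1 S1 S2.
set C := (X in smooth X _) in S3; exists C; move: S3; congr smooth.
apply/funext => x; by rewrite /smooth_step !mul1r !add0r ![- _ + x]addrC; field.
Qed.

Lemma measurable_smooth_step : measurable_fun setT smooth_step.
Proof.
have m (c : R) : measurable_fun setT (fun x : R => cube_pos (x - c)).
  apply: measurable_funX.
  apply: (measurableT_comp measurable_max0).
  exact: measurable_funB.
have m0 : measurable_fun setT cube_pos by apply: measurable_funX; exact: measurable_max0.
apply: measurable_funM => //; apply: measurable_funB => //.
apply: measurable_funD; last by apply: measurable_funM.
by apply: measurable_funB => //; apply: measurable_funM.
Qed.

Lemma smooth_step_le0 x : x <= 0 -> smooth_step x = 0.
Proof.
by move=> x0; rewrite /smooth_step !cube_pos_le; [field|lra..].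
Qed.

Lemma smooth_step_ge3 x : 3 <= x -> smooth_step x = 1.
Proof.
by move=> x0; rewrite /smooth_step !cube_pos_ge; [field|lra..].
Qed.

(** The difference is the cubic B-spline, a fourth finite difference of the
    truncated cube; its sign is checked on each unit interval of its support. *)
Lemma smooth_step_shift_le x : smooth_step (x - 1) <= smooth_step x.
Proof.
rewrite /smooth_step.
have -> : x - 1 - 1 = x - 2 by ring.
have -> : x - 1 - 2 = x - 3 by ring.
have -> : x - 1 - 3 = x - 4 by ring.
rewrite ler_pM2r// -subr_ge0.
set D := (X in 0 <= X).
have -> : D = cube_pos x - 4 * cube_pos (x - 1) + 6 * cube_pos (x - 2)
   - 4 * cube_pos (x - 3) + cube_pos (x - 4) by rewrite /D; ring.
have [x0|x0] := leP x 0; first by rewrite !cube_pos_le; lra.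
have [x1|x1] := leP x 1.
  rewrite (cube_pos_ge (ltW x0)) !cube_pos_le; [|lra..].
  by have := exprn_ge0 3 (ltW x0); lra.
have [x2|x2] := leP x 2.
  rewrite (cube_pos_ge (ltW x0)) (@cube_pos_ge (x - 1)) ?(@cube_pos_le (x - 2)) ?(@cube_pos_le (x - 3)) ?(@cube_pos_le (x - 4)); [|lra..].
  have -> : x ^+ 3 - 4 * (x - 1) ^+ 3 + 6 * 0 - 4 * 0 + 0 =
    4 - 6 * (2 - x) ^+ 2 + 3 * (2 - x) ^+ 3 by ring.
  set y := 2 - x; have y0 : 0 <= y by rewrite /y; lra.
  have y1 : y <= 1 by rewrite /y; lra.
  have : 0 <= (1 - y) * (1 + y * (1 - y)).
    have z0 : 0 <= 1 - y by rewrite subr_ge0.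
    by apply: mulr_ge0 => //; apply: addr_ge0 => //; exact: mulr_ge0.
  by rewrite (_ : (1 - y) * _ = 1 - 2 * y ^+ 2 + y ^+ 3); [lra|ring].
have [x3|x3] := leP x 3.
  rewrite (cube_pos_ge (ltW x0)) (@cube_pos_ge (x - 1)) ?(@cube_pos_ge (x - 2)) ?(@cube_pos_le (x - 3)) ?(@cube_pos_le (x - 4)); [|lra..].
  have -> : x ^+ 3 - 4 * (x - 1) ^+ 3 + 6 * (x - 2) ^+ 3 - 4 * 0 + 0 =
    4 - 6 * (x - 2) ^+ 2 + 3 * (x - 2) ^+ 3 by ring.
  set y := x - 2; have y0 : 0 <= y by rewrite /y; lra.
  have y1 : y <= 1 by rewrite /y; lra.
  have : 0 <= (1 - y) * (1 + y * (1 - y)).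
    have z0 : 0 <= 1 - y by rewrite subr_ge0.
    by apply: mulr_ge0 => //; apply: addr_ge0 => //; exact: mulr_ge0.
  by rewrite (_ : (1 - y) * _ = 1 - 2 * y ^+ 2 + y ^+ 3); [lra|ring].
have [x4|x4] := leP x 4.
  rewrite (cube_pos_ge (ltW x0)) (@cube_pos_ge (x - 1)) ?(@cube_pos_ge (x - 2)) ?(@cube_pos_ge (x - 3)) ?(@cube_pos_le (x - 4)); [|lra..].
  have -> : x ^+ 3 - 4 * (x - 1) ^+ 3 + 6 * (x - 2) ^+ 3 - 4 * (x - 3) ^+ 3 + 0 =
    (4 - x) ^+ 3 by ring.
  by apply: exprn_ge0; lra.
by rewrite !cube_pos_ge; [|lra..]; rewrite (_ : _ + _ = 0) //; ring.
Qed.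

(** Unit shifts are monotone, and integer shifts reach the constant values 0 and
    1. *)
Lemma smooth_step01 x : 0 <= smooth_step x <= 1.
Proof.
have mono n : smooth_step (x - n%:R) <= smooth_step x.
  elim: n => [|n IH]; first by rewrite subr0.
  apply: le_trans IH; rewrite -natr1 opprD addrA; exact: smooth_step_shift_le.
have mono' n : smooth_step x <= smooth_step (x + n%:R).
  elim: n => [|n IH]; first by rewrite addr0.
  apply: (le_trans IH); have := smooth_step_shift_le (x + n.+1%:R).
  by rewrite -natr1 addrA addrK.
apply/andP; split.
  have := mono (Num.truncn `|x|).+1; rewrite smooth_step_le0//.
  by rewrite subr_le0 (le_trans (ler_norm x))// ltW// truncnS_gt.
have := mono' (Num.truncn `|x|).+4; rewrite (@smooth_step_ge3 (x + _))//.
have := truncnS_gt `|x|; have := ler_norm (- x); rewrite normrN.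
by rewrite -(natr1 (Num.truncn `|x|).+3) -(natr1 (Num.truncn `|x|).+2) -(natr1 (Num.truncn `|x|).+1); lra.
Qed.

End step_function.

(** * Histories of draws *)

Section urn_histories.
Context {R : realType}.
Variables (a b : nat) (alpha : R).

(** A history lists the rounds, the latest first; bit [i] of a round tells
    whether a red ball is added to urn [i]. *)
Fixpoint urn (h : seq (seq bool)) (i : nat) : nat :=
  if h is z :: h' then (urn h' i + nth false z i)%N else a.

Definition urn_frac (h : seq (seq bool)) (i : nat) : R :=
  fraction a b (size h) (urn h i).

Definition urn_mean (N : nat) (h : seq (seq bool)) : R :=
  N%:R^-1 * \sum_(i < N) urn_frac h i.

Definition urn_prob (N : nat) (h : seq (seq bool)) (i : nat) : R :=
  alpha * urn_mean N h + (1 - alpha) * urn_frac h i.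

Definition urn_probs N h : seq R := mkseq (urn_prob N h) N.

(** The urns are numbered from 0 here, and the uniform variables from 1. *)
Fixpoint draws (N : nat) (u : nat -> nat -> R) (t : nat) : seq (seq bool) :=
  if t is s.+1 then
    mkseq (fun i => u s.+1 i.+1 <= urn_prob N (draws N u s) i) N :: draws N u s
  else [::].

Lemma size_draws N u t : size (draws N u t) = t.
Proof. by elim: t => //= t ->. Qed.

Lemma average_shift N (z : nat -> R) :
  average N z = N%:R^-1 * \sum_(i < N) z i.+1.
Proof. by rewrite /average big_add1 big_mkord. Qed.

Lemma red_balls_draws N u t i : (i < N)%N ->
  red_balls a b alpha N u t i.+1 = urn (draws N u t) i.
Proof.
elim: t i => [//|t IH] i iN.
rewrite /= IH//; congr addn; rewrite nth_mkseq//; congr (nat_of_bool (_ <= _)).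
rewrite /urn_prob average_shift /urn_mean /urn_frac size_draws.
by congr (_ * (_ * _) + _); apply: eq_bigr => j _; rewrite IH.
Qed.

Lemma total_fraction_draws N u t :
  total_fraction a b alpha N u t = urn_mean N (draws N u t).
Proof.
rewrite /total_fraction average_shift /urn_mean; congr (_ * _).
apply: eq_bigr => i _.
by rewrite /red_fraction red_balls_draws// /urn_frac size_draws.
Qed.

Lemma urn_le h i : (urn h i <= a + size h)%N.
Proof.
elim: h => [|z h IH] /=; first by rewrite addn0.
by rewrite addnS -addn1 leq_add// leq_b1.
Qed.

Lemma urn_frac01 h i : 0 <= urn_frac h i <= 1.
Proof.
rewrite /urn_frac /fraction divr_ge0//=.
have [->|n0] := eqVneq (size h + (a + b))%N 0%N; first by rewrite invr0 mulr0.
rewrite ler_pdivrMr ?ltr0n ?lt0n// mul1r ler_nat (leq_trans (urn_le _ _))//.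
by rewrite addnCA leq_add2l leq_addr.
Qed.

Lemma mean01 N (f : nat -> R) : (forall i, 0 <= f i <= 1) ->
  0 <= N%:R^-1 * \sum_(i < N) f i <= 1.
Proof.
move=> f01; have [->|n0] := posnP N.
  by rewrite invr0 mul0r lexx ler01.
have N0 : 0 < N%:R :> R by rewrite ltr0n.
rewrite mulr_ge0 ?invr_ge0 ?ler0n//=; last first.
  by apply: sumr_ge0 => i _; case/andP: (f01 i).
rewrite mulrC ler_pdivrMr// mul1r.
rewrite (le_trans (ler_sum _ (fun (i : 'I_N) _ => (andP (f01 i)).2)))//.
by rewrite sumr_const card_ord.
Qed.

Hypothesis alpha01 : 0 <= alpha <= 1.

Lemma urn_prob01 N h i : 0 <= urn_prob N h i <= 1.
Proof.
have /andP[x0 x1] := mean01 N (urn_frac01 h).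
have /andP[y0 y1] := urn_frac01 h i.
have /andP[a0 a1] := alpha01.
rewrite /urn_prob; rewrite -/(urn_mean N h) in x0 x1.
by apply/andP; split; nra.
Qed.

Lemma urn_probs01 N h p : p \in urn_probs N h -> 0 <= p <= 1.
Proof. by move=> /mapP[i _ ->]; exact: urn_prob01. Qed.

Fixpoint bern_avg (ps : seq R) (F : seq bool -> R) : R :=
  if ps is p :: ps' then
    p * bern_avg ps' (fun z => F (true :: z))
    + (1 - p) * bern_avg ps' (fun z => F (false :: z))
  else F [::].

(** The expectation of a function of the history: the last round is averaged
    first, conditionally on the earlier ones. *)
Fixpoint hist_avg (N t : nat) (F : seq (seq bool) -> R) : R :=
  if t is s.+1 then
    hist_avg N s (fun h => bern_avg (urn_probs N h) (fun z => F (z :: h)))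
  else F [::].

Fixpoint bitseqs (N : nat) : seq (seq bool) :=
  if N is n.+1 then map (cons true) (bitseqs n) ++ map (cons false) (bitseqs n)
  else [:: [::]].

Fixpoint hists (N t : nat) : seq (seq (seq bool)) :=
  if t is s.+1 then [seq z :: h | h <- hists N s, z <- bitseqs N] else [:: [::]].

Definition bern_weight (ps : seq R) (z : seq bool) : R :=
  \prod_(i < size ps) (if nth false z i then nth 0 ps i else 1 - nth 0 ps i).

Fixpoint hist_weight (N : nat) (h : seq (seq bool)) : R :=
  if h is z :: h' then hist_weight N h' * bern_weight (urn_probs N h') z else 1.

Lemma bern_avgE ps F :
  bern_avg ps F = \sum_(z <- bitseqs (size ps)) bern_weight ps z * F z.
Proof.
elim: ps F => [|p ps IH] F /=.
  by rewrite big_seq1 /bern_weight big_ord0 mul1r.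
rewrite big_cat/= !big_map !IH !big_distrr/=; congr (_ + _);
  by apply: eq_bigr => z _; rewrite /bern_weight/= big_ord_recl/= mulrA.
Qed.

Lemma hist_avgE N t F :
  hist_avg N t F = \sum_(h <- hists N t) hist_weight N h * F h.
Proof.
elim: t F => [|t IH] F /=; first by rewrite big_seq1 mul1r.
rewrite IH big_allpairs_dep/=; apply: eq_bigr => h _.
rewrite bern_avgE size_mkseq big_distrr/=.
by apply: eq_bigr => z _; rewrite mulrA.
Qed.

Lemma mem_bitseqs N z : (z \in bitseqs N) = (size z == N).
Proof.
have E (c c' : bool) (y : seq bool) (l : seq (seq bool)) :
    (c :: y \in map (cons c') l) = (c == c') && (y \in l).
  apply/mapP/andP => [[x xl [-> ->]]|[/eqP-> yl]]; first by rewrite eqxx.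
  by exists y.
elim: N z => [|N IH] [|c z]//=.
  by rewrite mem_cat; apply/negbTE/norP; split; apply/negP => /mapP[].
by rewrite mem_cat !E eqSS -IH; case: c; rewrite ?orbF.
Qed.

Lemma uniq_bitseqs N : uniq (bitseqs N).
Proof.
elim: N => //= N IH; rewrite cat_uniq !map_inj_uniq ?IH/= ?andbT; try by move=> ? ? [].
by apply/hasPn => _ /mapP[z _ ->]; apply/negP => /mapP[].
Qed.

Lemma uniq_hists N t : uniq (hists N t).
Proof.
elim: t => //= t IH; apply: allpairs_uniq => //; first exact: uniq_bitseqs.
by move=> [h z] [h' z'] _ _ /= [-> ->].
Qed.

Lemma draws_hists N u t : draws N u t \in hists N t.
Proof.
elim: t => //= t IH; apply/allpairsPdep.
exists (draws N u t), (mkseq (fun i => u t.+1 i.+1 <= urn_prob N (draws N u t) i) N).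
by split => //; rewrite mem_bitseqs size_mkseq.
Qed.

Lemma bern_avg_le ps F G : (forall p, p \in ps -> 0 <= p <= 1) ->
  (forall z, F z <= G z) -> bern_avg ps F <= bern_avg ps G.
Proof.
elim: ps F G => [|p ps IH] F G Hp FG //=.
have /andP[p0 p1] := Hp p (mem_head _ _).
have {}IH F' G' := IH F' G' (fun q h => Hp q (mem_behead (s := p :: ps) h)).
by rewrite lerD// ler_wpM2l ?subr_ge0// IH.
Qed.

Lemma bern_avg_comb ps (k k' : R) F G :
  bern_avg ps (fun z => k * F z + k' * G z) = k * bern_avg ps F + k' * bern_avg ps G.
Proof. by elim: ps F G => [|p ps IH] F G //=; rewrite !IH; ring. Qed.

Lemma eq_bern_avg ps F G : (forall z, F z = G z) -> bern_avg ps F = bern_avg ps G.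
Proof. by move=> FG; congr bern_avg; apply/funext. Qed.

Lemma bern_avg_cst ps (c : R) : bern_avg ps (fun=> c) = c.
Proof. by elim: ps => [|p ps IH] //=; rewrite IH; ring. Qed.

Lemma hist_avg_le N t F G : (forall h, size h = t -> F h <= G h) ->
  hist_avg N t F <= hist_avg N t G.
Proof.
elim: t F G => [|t IH] F G FG /=; first exact: FG.
apply: IH => h ht; apply: bern_avg_le; first exact: urn_probs01.
by move=> z; apply: FG; rewrite /= ht.
Qed.

Lemma eq_hist_avg N t F G : (forall h, size h = t -> F h = G h) ->
  hist_avg N t F = hist_avg N t G.
Proof.
by move=> FG; apply/eqP; rewrite eq_le; apply/andP; split;
  apply: hist_avg_le => h /FG ->.
Qed.

Lemma hist_avg_comb N t (k k' : R) F G :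
  hist_avg N t (fun h => k * F h + k' * G h) = k * hist_avg N t F + k' * hist_avg N t G.
Proof.
elim: t F G => [|t IH] F G //=; rewrite -IH.
by apply: eq_hist_avg => h _; rewrite bern_avg_comb.
Qed.

Lemma hist_avg_cst N t (c : R) : hist_avg N t (fun=> c) = c.
Proof.
elim: t => //= t IH; rewrite -[RHS]IH.
by apply: eq_hist_avg => h _; rewrite bern_avg_cst.
Qed.

Lemma hist_avg_norm N t F : `|hist_avg N t F| <= hist_avg N t (fun h => `|F h|).
Proof.
rewrite ler_norml; apply/andP; split; last by apply: hist_avg_le => h _; exact: ler_norm.
rewrite lerNl -[- _]addr0 -mulN1r -[0](mul0r (hist_avg N t F)) -hist_avg_comb.
by apply: hist_avg_le => h _; rewrite mul0r addr0 mulN1r -normrN ler_norm.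
Qed.

End urn_histories.

(** * The law of the history *)

Section urn_probability.
Context {R : realType}.
Variables (a b : nat) (alpha : R).
Hypothesis alpha01 : 0 <= alpha <= 1.
Context (d : measure_display) (T : measurableType d) (P : probability T R).
Variable U : nat -> nat -> {RV P >-> R}.
Hypothesis U_indep : mutually_independent P (fun p : nat * nat => U p.1 p.2).
Hypothesis U_uniform : forall t i, has_law P (U t i) (uniform_prob (@ltr01 R)).

Let u (w : T) (s i : nat) : R := U s i w.
Let dr N w t := draws a b alpha N (u w) t.

Lemma uniform_prob_le (p : R) : 0 <= p <= 1 ->
  uniform_prob (@ltr01 R) [set x | x <= p] = p%:E.
Proof.
move=> /andP[p0 p1]; rewrite /uniform_prob integral_uniform_pdf.
rewrite (_ : _ `&` _ = `[0, p]%classic); last first.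
  apply/seteqP; split => x /=; rewrite !in_itv/=.
    by move=> [xp /andP[->]].
  by move=> /andP[-> xp]; split => //; rewrite (le_trans xp).
rewrite (eq_integral (fun=> 1%E)); last first.
  move=> x; rewrite inE/= in_itv/= => /andP[x0 xp].
  by rewrite /uniform_pdf x0 (le_trans xp)// subr0 invr1.
rewrite integral_cst//= mul1e lebesgue_measure_itv/= lte_fin.
case: ltP => [_|p0']; first by rewrite oppr0 adde0.
by congr EFin; apply/eqP; rewrite eq_le p0 p0'.
Qed.

Definition bit_set (p : R) (c : bool) : set R :=
  if c then [set x | x <= p] else ~` [set x | x <= p].

Lemma measurable_bit_set p c : measurable (bit_set p c).
Proof.
have m : measurable [set x : R | x <= p].
  rewrite (_ : [set _ | _] = `]-oo, p]%classic)//.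
by case: c => //=; exact: measurableC.
Qed.

Lemma bit_setP p c x : bit_set p c x <-> (x <= p) = c.
Proof.
case: c => /=; first by [].
by split => [/negP/negbTE|->].
Qed.

Lemma uniform_prob_bit_set p c : 0 <= p <= 1 ->
  uniform_prob (@ltr01 R) (bit_set p c) = (if c then p else 1 - p)%:E.
Proof.
move=> p01; case: c => /=; first exact: uniform_prob_le.
have /= m := measurable_bit_set p true.
rewrite probability_setC// EFinB; congr (1 - _)%E; exact: uniform_prob_le.
Qed.

Fixpoint draw_index (N t : nat) : seq (nat * nat) :=
  if t is s.+1 then [seq (s.+1, i.+1) | i <- iota 0 N] ++ draw_index N s else [::].

Lemma draw_index_le N t p : p \in draw_index N t -> (p.1 <= t)%N.
Proof.
elim: t => //= t IH; rewrite mem_cat => /orP[/mapP[i _ ->]//|/IH].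
by move=> /leq_trans; exact.
Qed.

Lemma uniq_draw_index N t : uniq (draw_index N t).
Proof.
elim: t => //= t IH; rewrite cat_uniq IH andbT map_inj_uniq ?iota_uniq/=; last first.
  by move=> i j [].
apply/hasPn => p /draw_index_le p_le; apply/negP => /mapP[i _ pE].
by move: p_le; rewrite pE ltnn.
Qed.

(** The thresholds of a round are determined by the earlier rounds of the
    history, so prescribing the history constrains each uniform variable
    separately. Independence then applies although the thresholds are random. *)
Lemma draws_event N t h : h \in hists N t ->
  exists A : nat * nat -> set R, [/\ forall p, measurable (A p),
    forall w, dr N w t = h <-> (forall p, p \in draw_index N t -> A p (U p.1 p.2 w)) &
    (\prod_(p <- draw_index N t) P (U p.1 p.2 @^-1` A p))%E =
    (hist_weight a b alpha N h)%:E].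
Proof.
elim: t h => [|t IH] h /=.
  rewrite inE => /eqP ->; exists (fun=> setT); split => //.
  by rewrite big_nil.
move=> /allpairsPdep[h' [z [h'N zN ->{h}]]].
have [A [mA AE AP]] := IH h' h'N.
pose q := urn_prob a b alpha N h'.
pose A' (p : nat * nat) := if p.1 == t.+1 then bit_set (q p.2.-1) (nth false z p.2.-1)
  else A p.
have A'A p : p \in draw_index N t -> A' p = A p.
  by move=> /draw_index_le p_le; rewrite /A' ltn_eqF.
exists A'; split.
- by move=> p; rewrite /A'; case: ifP => // _; exact: measurable_bit_set.
- move=> w; rewrite /dr/= -/(dr N w t); split.
    move=> [zE hE] p; rewrite mem_cat => /orP[/mapP[i]|pt].
      rewrite mem_iota add0n => /andP[_ iN] -> /=.
      rewrite /A' /= eqxx; apply/bit_setP.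
      by rewrite -zE nth_mkseq// /q -hE.
    by rewrite A'A//; move/AE: hE; exact.
  move=> H; have hE : dr N w t = h'.
    apply/AE => p pt; rewrite -A'A//; apply: H.
    by rewrite mem_cat pt orbT.
  rewrite hE; congr cons.
  move: zN; rewrite mem_bitseqs => /eqP zN.
  apply: (@eq_from_nth _ false); first by rewrite size_mkseq.
  move=> i; rewrite size_mkseq => iN; rewrite nth_mkseq//.
  have : (t.+1, i.+1) \in [seq (t.+1, i.+1) | i <- iota 0 N] ++ draw_index N t.
    by rewrite mem_cat map_f// mem_iota.
  by move=> /H; rewrite /A'/= eqxx => /bit_setP.
- rewrite big_cat/= big_map muleC (eq_big_seq (fun p => P (U p.1 p.2 @^-1` A p))); last first.
    by move=> p /A'A ->.
  rewrite AP EFinM; congr (_ * _)%E.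
  rewrite /bern_weight size_mkseq -prodEFin.
  have -> : iota 0 N = index_iota 0 N by rewrite /index_iota subn0.
  rewrite big_mkord; apply: eq_bigr => i _.
  rewrite /A'/= eqxx.
  rewrite -[P _]/(pushforward P (U t.+1 i.+1) _) U_uniform; last exact: measurable_bit_set.
  by rewrite uniform_prob_bit_set ?urn_prob01// nth_mkseq.
Qed.

Lemma prob_draws N t h : h \in hists N t ->
  measurable [set w | dr N w t = h] /\
  P [set w | dr N w t = h] = (hist_weight a b alpha N h)%:E.
Proof.
move=> hN; have [A [mA AE <-]] := draws_event hN.
have SE : [set w | dr N w t = h] =
   \bigcap_(i in [set` [fset p in draw_index N t]%fset]) (U i.1 i.2 @^-1` A i).
  apply/seteqP; split => w /=.
    by move=> /AE H p /=; rewrite inE => pt; exact: H.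
  by move=> H; apply/AE => p pt; apply: H; rewrite /= inE.
split.
  rewrite SE; apply: fin_bigcap_measurable; first exact: finite_fset.
  move=> p _; rewrite -[X in measurable X]setTI; exact: measurable_funP.
rewrite SE U_indep//.
apply: perm_big; apply: uniq_perm => //; first exact: uniq_draw_index.
by move=> p; rewrite inE.
Qed.

Lemma measurable_draws N t h : measurable [set w | dr N w t = h].
Proof.
have [hN|hN] := boolP (h \in hists N t); first exact: (prob_draws hN).1.
rewrite (_ : [set _ | _] = set0)//; apply/seteqP; split => // w /= hw.
by move/negP: hN; apply; rewrite -hw draws_hists.
Qed.

Lemma draws_funE N t (F : seq (seq bool) -> R) w : F (dr N w t) =
  \sum_(h <- hists N t) F h * \1_[set w | dr N w t = h] w.
Proof.
rewrite (bigD1_seq (dr N w t))/=; [|exact: draws_hists|exact: uniq_hists].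
rewrite indicE mem_set// mulr1 big1_seq ?addr0// => h /andP[hw _].
by rewrite indicE memNset ?mulr0//= => /esym/eqP; apply/negP.
Qed.

Lemma measurable_draws_fun N t (F : seq (seq bool) -> R) :
  measurable_fun setT (fun w => F (dr N w t)).
Proof.
under eq_fun do rewrite draws_funE.
apply: measurable_sum => h; apply: measurable_funM => //.
by apply: measurable_indic; exact: measurable_draws.
Qed.

(** The history takes finitely many values, with the probabilities of
    [prob_draws]. *)
Lemma expectation_draws N t (F : seq (seq bool) -> R) :
  ('E_P[fun w => F (dr N w t)] = (hist_avg a b alpha N t F)%:E)%E.
Proof.
rewrite unlock; under eq_integral do rewrite draws_funE -sumEFin.
have mh h := measurable_draws N t h.
have ih h : P.-integrable setT (EFin \o \1_[set w | dr N w t = h]).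
  apply: test_function_integrable; first exact: measurable_indic.
  by move=> w; rewrite indicE; case: (_ \in _); rewrite ?lexx ?ler01.
rewrite integral_sum//; last first.
  by move=> h; apply: (@integrable_mulr _ _ _ P (F h)); exact: ih.
rewrite hist_avgE// -sumEFin; apply: eq_big_seq => h hN.
under eq_integral do rewrite EFinM.
rewrite integralZl//; last exact: ih.
by rewrite integral_indic//= setIT (prob_draws hN).2 -EFinM mulrC.
Qed.

End urn_probability.

(** * The limit variance *)

Section limit_variance_bounds.
Context {R : realType}.
Variables (a b : nat) (alpha : R).
Hypotheses (a_gt0 : (0 < a)%N) (alpha01 : 0 <= alpha <= 1).

Let q : R := a%:R / (a + b)%:R.
Let n (t : nat) : R := (t + (a + b) + 1)%:R.

Lemma start_fraction01 : 0 <= q <= 1.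
Proof.
rewrite /q divr_ge0//= ler_pdivrMr ?ltr0n ?addn_gt0 ?a_gt0//.
by rewrite mul1r ler_nat leq_addr.
Qed.

Lemma time_ge1 t : 1 <= n t.
Proof. by rewrite /n ler1n addn1. Qed.

Lemma start_varE : a%:R / (a + b)%:R - a%:R ^+ 2 / (a + b)%:R ^+ 2 = q - q ^+ 2 :> R.
Proof. by rewrite /q expr_div_n. Qed.

(** With [k] the inverse of [n t], the recursion has the nonnegative
    coefficients [(1 - k) (1 + (1 - 2 alpha) k)] and [k ^ 2]. *)
Lemma limit_varianceS t : limit_variance a b alpha t.+1 =
  (1 - (n t)^-1) * (1 + (1 - 2 * alpha) * (n t)^-1) * limit_variance a b alpha t
  + (n t)^-1 ^+ 2 * (q - q ^+ 2).
Proof.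
have n0 : n t != 0 by rewrite gt_eqF// (lt_le_trans _ (time_ge1 t)).
by rewrite /= start_varE -/(n t); field.
Qed.

(** The coefficient of [limit_variance] in [limit_varianceS] is at most
    [1 - k ^ 2], and [(1 - k ^ 2) v + k ^ 2 v = v] for [v = q - q ^ 2]. *)
Lemma limit_variance_bound t : 0 <= limit_variance a b alpha t <= q - q ^+ 2.
Proof.
have /andP[q0 q1] := start_fraction01.
have v0 : 0 <= q - q ^+ 2 by rewrite expr2 -{1}[q]mulr1 -mulrBr mulr_ge0// subr_ge0.
elim: t => [|t /andP[x0 xv]]; first by rewrite /= lexx v0.
rewrite limit_varianceS; have n1 := time_ge1 t.
set k := (n t)^-1; set x := limit_variance _ _ _ _ in x0 xv *.
have k0 : 0 <= k by rewrite invr_ge0 (le_trans _ n1).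
have k1 : k <= 1 by rewrite invf_le1// (lt_le_trans _ n1).
have /andP[a0 a1] := alpha01.
have c0 : 0 <= (1 - k) * (1 + (1 - 2 * alpha) * k) by apply: mulr_ge0; nra.
have c1 : (1 - k) * (1 + (1 - 2 * alpha) * k) <= 1 - k ^+ 2.
  rewrite -subr_ge0 (_ : _ - _ = 2 * (alpha * (k * (1 - k)))); last by ring.
  by rewrite !mulr_ge0// subr_ge0.
apply/andP; split; first by apply: addr_ge0; apply: mulr_ge0 => //; exact: sqr_ge0.
have : (1 - k) * (1 + (1 - 2 * alpha) * k) * x <= (1 - k ^+ 2) * (q - q ^+ 2).
  by rewrite ler_pM.
lra.
Qed.

Lemma sigma2E t : sigma2 a b alpha t =
  (n t)^-1 ^+ 2 * (q - q ^+ 2 - (1 - alpha) ^+ 2 * limit_variance a b alpha t).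
Proof. by rewrite /sigma2 start_varE -/(n t) exprVn div1r. Qed.

Lemma sigma2_bound t : 0 <= sigma2 a b alpha t <= 1.
Proof.
rewrite sigma2E; have n1 := time_ge1 t.
have /andP[x0 xv] := limit_variance_bound t.
have /andP[q0 q1] := start_fraction01.
have /andP[a0 a1] := alpha01.
set k := (n t)^-1; set x := limit_variance _ _ _ _ in x0 xv *.
have k0 : 0 <= k by rewrite invr_ge0 (le_trans _ n1).
have k1 : k <= 1 by rewrite invf_le1// (lt_le_trans _ n1).
have b1 : (1 - alpha) ^+ 2 <= 1 by rewrite expr_le1//; lra.
have b0 := sqr_ge0 (1 - alpha).
have bx : (1 - alpha) ^+ 2 * x <= 1 * x by rewrite ler_wpM2r.
have bx0 : 0 <= (1 - alpha) ^+ 2 * x by rewrite mulr_ge0.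
have q20 := sqr_ge0 q.
have k20 : 0 <= k ^+ 2 := sqr_ge0 k.
have k21 : k ^+ 2 <= 1 by rewrite expr_le1.
rewrite mulr_ge0//=; last by lra.
by rewrite mulr_ile1//; lra.
Qed.

End limit_variance_bounds.

(** * Sums of independent Bernoulli variables *)

Section bernoulli_sums.
Context {R : realType}.

Lemma sum_mkseq (T : Type) (f : nat -> T) (N : nat) (F : T -> R) :
  \sum_(x <- mkseq f N) F x = \sum_(i < N) F (f i).
Proof.
rewrite big_map (_ : iota 0 N = index_iota 0 N); first by rewrite big_mkord.
by rewrite /index_iota subn0.
Qed.

Lemma bern_avg_sum (l : seq (R * R)) (g : R -> R) (x : R) :
  bern_avg (map snd l) (fun z => g (x + \sum_(i < size l)
     (nth (0, 0) l i).1 * ((nth false z i)%:R - (nth (0, 0) l i).2))) =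
  bern_ops l g x.
Proof.
elim: l x => [|[c p] l IH] x /=; first by rewrite big_ord0 addr0.
rewrite /bern_op /=; congr (_ * _ + _ * _); rewrite -IH; apply: eq_bern_avg => z;
  by rewrite big_ord_recl/= addrA ?(sub0r, mulrN).
Qed.

Lemma bern_avg_mkseq (N : nat) (c p : nat -> R) (g : R -> R) :
  bern_avg (mkseq p N)
    (fun z => g (\sum_(i < N) c i * ((nth false z i)%:R - p i))) =
  bern_ops (mkseq (fun i => (c i, p i)) N) g 0.
Proof.
rewrite -bern_avg_sum -[in RHS]map_comp size_mkseq.
apply: eq_bern_avg => z; rewrite add0r; congr g.
by apply: eq_bigr => i _; rewrite nth_mkseq.
Qed.

Lemma bern_ops_sqr (l : seq (R * R)) (x : R) : bern_ops l (fun y => y ^+ 2) x =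
  x ^+ 2 + \sum_(cp <- l) cp.1 ^+ 2 * (cp.2 * (1 - cp.2)).
Proof.
elim: l x => [|[c p] l IH] x /=; first by rewrite big_nil addr0.
by rewrite /bern_op !IH big_cons /=; ring.
Qed.

Lemma bern_avg_variance (N : nat) (c p : nat -> R) :
  bern_avg (mkseq p N)
    (fun z => (\sum_(i < N) c i * ((nth false z i)%:R - p i)) ^+ 2) =
  \sum_(i < N) c i ^+ 2 * (p i * (1 - p i)).
Proof.
rewrite (bern_avg_mkseq N c p (fun y => y ^+ 2)) bern_ops_sqr expr0n add0r.
by rewrite sum_mkseq.
Qed.

(** With [r = sqrt N] and [y] the average, [|y| <= r^-1 / 2 + r y ^ 2 / 2], and
    [y ^ 2] has mean at most [1 / N]. *)
Lemma bern_avg_lln (N : nat) (c p : nat -> R) : (0 < N)%N ->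
  (forall i, `|c i| <= 1) -> (forall i, 0 <= p i <= 1) ->
  bern_avg (mkseq p N)
    (fun z => `|N%:R^-1 * \sum_(i < N) c i * ((nth false z i)%:R - p i)|)
  <= (Num.sqrt N%:R)^-1.
Proof.
move=> N0 c1 p01; have NR0 : 0 < N%:R :> R by rewrite ltr0n.
set r := Num.sqrt N%:R.
have r0 : 0 < r by rewrite sqrtr_gt0.
have rr : r ^+ 2 = N%:R by rewrite sqr_sqrtr// ltW.
pose M z := \sum_(i < N) c i * ((nth false z i)%:R - p i) : R.
have p01' q : q \in mkseq p N -> 0 <= q <= 1 by move=> /mapP[i _ ->].
have le1 z : `|N%:R^-1 * M z| <= (r^-1 / 2) * 1 + (r / (2 * N%:R ^+ 2)) * M z ^+ 2.
  set y := N%:R^-1 * M z.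
  have -> : (r / (2 * N%:R ^+ 2)) * M z ^+ 2 = r / 2 * y ^+ 2.
    by rewrite /y; field; rewrite gt_eqF.
  rewrite -real_normK ?num_real//.
  have : 0 <= r / 2 * (`|y| - r^-1) ^+ 2 by rewrite mulr_ge0 ?divr_ge0 ?sqr_ge0// ltW.
  have -> : r / 2 * (`|y| - r^-1) ^+ 2 = r / 2 * `|y| ^+ 2 - `|y| + r^-1 / 2.
    by field; rewrite gt_eqF.
  lra.
rewrite (le_trans (bern_avg_le p01' le1))//.
rewrite bern_avg_comb bern_avg_cst bern_avg_variance.
have : \sum_(i < N) c i ^+ 2 * (p i * (1 - p i)) <= N%:R.
  rewrite -[N in leRHS]card_ord -sumr_const ler_sum// => i _.
  have /andP[p0 p1] := p01 i.
  rewrite mulr_ile1 ?sqr_ge0 ?mulr_ge0 ?subr_ge0//.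
    by rewrite -real_normK ?num_real// expr_le1.
  by rewrite mulr_ile1 ?subr_ge0// lerBlDr lerDl.
set V := \sum_(i < N) _ => VN.
have k0 : 0 <= r / (2 * N%:R ^+ 2) by rewrite divr_ge0 ?mulr_ge0 ?sqr_ge0 ?ltW.
have : r / (2 * N%:R ^+ 2) * V <= r / (2 * N%:R ^+ 2) * N%:R by rewrite ler_wpM2l.
have -> : r / (2 * N%:R ^+ 2) * N%:R = r^-1 / 2.
  by rewrite -rr; field; rewrite gt_eqF.
lra.
Qed.

End bernoulli_sums.

(** * Law of large numbers for the urn fractions *)

Section urn_limit.
Context {R : realType}.
Variables (a b : nat) (alpha : R).
Hypotheses (a_gt0 : (0 < a)%N) (alpha01 : 0 <= alpha <= 1).

Let q : R := a%:R / (a + b)%:R.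
Local Notation nn t := ((t + (a + b) + 1)%:R : R).
Local Notation frac := (urn_frac a b).
Local Notation mean := (urn_mean a b).
Local Notation prob := (urn_prob a b alpha).
Local Notation probs := (urn_probs a b alpha).
Local Notation havg := (hist_avg a b alpha).
Local Notation x_ t := (limit_variance a b alpha t).

Definition urn_mean_sqr (N : nat) (h : seq (seq bool)) : R :=
  N%:R^-1 * \sum_(i < N) frac h i ^+ 2.

Lemma urn_frac_cons z h i :
  frac (z :: h) i = ((nn (size h) - 1) * frac h i + (nth false z i)%:R) / nn (size h) :> R.
Proof.
rewrite /urn_frac /fraction /= natrD addn1 addSn -natr1 addrK.
have n0 : (size h + (a + b))%:R != 0 :> R by rewrite pnatr_eq0 -lt0n addn_gt0 addn_gt0 a_gt0 orbT.
by rewrite [_ * (_ / _)]mulrC divfK.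
Qed.

Lemma mean_cst (N : nat) (c : R) : (0 < N)%N -> N%:R^-1 * (\sum_(i < N) c) = c.
Proof.
move=> N0; rewrite sumr_const card_ord -[c *+ N]mulr_natl mulrA mulVf ?mul1r//.
by rewrite pnatr_eq0 -lt0n.
Qed.

Lemma mean_prob N h : (0 < N)%N -> N%:R^-1 * \sum_(i < N) prob N h i = mean N h.
Proof.
move=> N0; rewrite /urn_prob big_split/= mulrDr mean_cst// -mulr_sumr.
by rewrite /urn_mean; ring.
Qed.

Lemma mean_prob_sqr N h : (0 < N)%N -> N%:R^-1 * \sum_(i < N) prob N h i ^+ 2 =
  (1 - (1 - alpha) ^+ 2) * mean N h ^+ 2 + (1 - alpha) ^+ 2 * urn_mean_sqr N h.
Proof.
move=> N0; rewrite (eq_bigr (fun i : 'I_N => (alpha * mean N h) ^+ 2 +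
  (2 * (alpha * (1 - alpha)) * mean N h * frac h i
   + (1 - alpha) ^+ 2 * frac h i ^+ 2))); last first.
  by move=> i _; rewrite /urn_prob; ring.
rewrite !big_split/= !mulrDr mean_cst// -!mulr_sumr /urn_mean_sqr /urn_mean.
ring.
Qed.

(** The martingale part of a weighted average of the draws of one round. *)
Definition noise (N : nat) (h : seq (seq bool)) (c : nat -> R) (z : seq bool) : R :=
  N%:R^-1 * \sum_(i < N) c i * ((nth false z i)%:R - prob N h i).

(** The parameters of the draws average to the current mean, so the drift
    cancels: this is the martingale property of the total fraction. *)
Lemma urn_mean_cons N z h : (0 < N)%N ->
  mean N (z :: h) = mean N h + (nn (size h))^-1 * noise N h (fun=> 1) z.
Proof.
move=> N0; have n0 : nn (size h) != 0 by rewrite pnatr_eq0 addn1.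
rewrite {1}/urn_mean; under eq_bigr do rewrite urn_frac_cons.
rewrite -mulr_suml big_split/= -mulr_sumr /noise.
under [in RHS]eq_bigr do rewrite mul1r.
rewrite sumrB mulrBr mean_prob//.
have N1 : N%:R != 0 :> R by rewrite pnatr_eq0 -lt0n.
rewrite /urn_mean; move: (nn (size h)) n0 => n n0.
by field; rewrite n0 N1.
Qed.

(** A bit equals its square, so the new mean square is affine in the bits of the
    round. *)
Lemma urn_mean_sqr_cons N z h : (0 < N)%N ->
  urn_mean_sqr N (z :: h) = (nn (size h))^-1 ^+ 2 *
    ((nn (size h) - 1) ^+ 2 * urn_mean_sqr N h
     + 2 * (nn (size h) - 1) * (alpha * mean N h ^+ 2 + (1 - alpha) * urn_mean_sqr N h
         + noise N h (frac h) z)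
     + (mean N h + noise N h (fun=> 1) z)).
Proof.
move=> N0; have n0 : nn (size h) != 0 by rewrite pnatr_eq0 addn1.
have N1 : N%:R != 0 :> R by rewrite pnatr_eq0 -lt0n.
have E1 : mean N h + noise N h (fun=> 1) z = N%:R^-1 * \sum_(i < N) (nth false z i)%:R.
  rewrite /noise; under eq_bigr do rewrite mul1r.
  by rewrite sumrB mulrBr mean_prob//; ring.
have E2 : alpha * mean N h ^+ 2 + (1 - alpha) * urn_mean_sqr N h
         + noise N h (frac h) z = N%:R^-1 * \sum_(i < N) frac h i * (nth false z i)%:R.
  rewrite /noise; under eq_bigr do rewrite mulrBr.
  rewrite sumrB mulrBr.
  rewrite [X in _ + (_ - X)](_ : _ = alpha * mean N h ^+ 2 + (1 - alpha) * urn_mean_sqr N h).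
    by ring.
  rewrite /urn_prob; under eq_bigr do rewrite mulrDr [frac h _ * ((1 - alpha) * _)]mulrCA -expr2.
  by rewrite big_split/= mulrDr -mulr_suml -mulr_sumr /urn_mean /urn_mean_sqr; ring.
rewrite E1 E2 {1}/urn_mean_sqr.
under eq_bigr => i _.
  have -> : frac (z :: h) i ^+ 2 = (nn (size h))^-1 ^+ 2 *
     ((nn (size h) - 1) ^+ 2 * frac h i ^+ 2
      + 2 * (nn (size h) - 1) * (frac h i * (nth false z i)%:R) + (nth false z i)%:R).
    rewrite urn_frac_cons.
    have : (nth false z i)%:R ^+ 2 = (nth false z i)%:R :> R.
      by case: (nth false z i); rewrite ?expr1n ?expr0n.
    move: (nn (size h)) n0 => n n0; set y := (nth false z i)%:R => yy.
    have -> : (((n - 1) * frac h i + y) / n) ^+ 2 = n^-1 ^+ 2 *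
      ((n - 1) ^+ 2 * frac h i ^+ 2 + 2 * (n - 1) * (frac h i * y) + y ^+ 2) by field.
    by rewrite yy.
  over.
by rewrite -mulr_sumr !big_split/= -!mulr_sumr /urn_mean_sqr; ring.
Qed.

(** The limit of the mean square is the limit variance plus the square of the
    mean. *)
Definition deviation (N : nat) (h : seq (seq bool)) : R :=
  `|mean N h - q| + `|urn_mean_sqr N h - (x_ (size h) + q ^+ 2)|.

(** The limit values solve the two recursions without noise, so the differences
    solve linear recursions; their coefficients are bounded by absolute
    constants because all fractions lie between 0 and 1. *)
Lemma deviation_cons N z h : (0 < N)%N ->
  deviation N (z :: h) <= 6 * deviation N h
    + 2 * (`|noise N h (fun=> 1) z| + `|noise N h (frac h) z|).
Proof.
move=> N0; rewrite /deviation urn_mean_cons// urn_mean_sqr_cons//.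
rewrite -[size (z :: h)]/(size h).+1 (limit_varianceS a b alpha (size h)) -/q.
set k := (nn (size h))^-1.
have n1 : 1 <= nn (size h) := time_ge1 a b (size h).
have k0 : 0 <= k by rewrite invr_ge0 (le_trans _ n1).
have k1 : k <= 1 by rewrite invf_le1// (lt_le_trans _ n1).
have nE : nn (size h) = k^-1 by rewrite invrK.
have kn0 : k != 0 by rewrite invr_eq0 gt_eqF// (lt_le_trans _ n1).
rewrite !nE.
set M1 := noise N h (fun=> 1) z; set M2 := noise N h (frac h) z.
set Z := mean N h; set S := urn_mean_sqr N h; set x := x_ (size h).
have /andP[al0 al1] := alpha01.
have /andP[Z0 Z1] : 0 <= Z <= 1 by apply: mean01 => i; exact: urn_frac01.
have /andP[q0 q1] : 0 <= q <= 1 by exact: start_fraction01.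
have -> : k ^+ 2 * ((k^-1 - 1) ^+ 2 * S + 2 * (k^-1 - 1) * (alpha * Z ^+ 2 + (1 - alpha) * S + M2) + (Z + M1))
  - ((1 - k) * (1 + (1 - 2 * alpha) * k) * x + k ^+ 2 * (q - q ^+ 2) + q ^+ 2)
  = (1 - k) * (1 + (1 - 2 * alpha) * k) * (S - (x + q ^+ 2))
    + 2 * alpha * (k * (1 - k)) * (Z + q) * (Z - q)
    + 2 * (k * (1 - k)) * M2 + k ^+ 2 * (Z - q) + k ^+ 2 * M1.
  by field.
have kk0 : 0 <= k * (1 - k) by rewrite mulr_ge0// subr_ge0.
have kk1 : k * (1 - k) <= 1 by nra.
have k20 : 0 <= k ^+ 2 := sqr_ge0 k.
have k21 : k ^+ 2 <= 1 by rewrite expr_le1.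
have c0 : 0 <= (1 - k) * (1 + (1 - 2 * alpha) * k) by apply: mulr_ge0; nra.
have c1 : (1 - k) * (1 + (1 - 2 * alpha) * k) <= 1.
  rewrite -subr_ge0 (_ : _ - _ = 2 * (alpha * (k * (1 - k))) + k ^+ 2); last by ring.
  by rewrite addr_ge0// mulr_ge0// mulr_ge0.
have bd (c y C : R) : 0 <= c -> c <= C -> `|c * y| <= C * `|y|.
  by move=> cp cC; rewrite normrM ger0_norm// ler_wpM2r.
have b1 := bd _ (S - (x + q ^+ 2)) 1 c0 c1.
have b2 : `|2 * alpha * (k * (1 - k)) * (Z + q) * (Z - q)| <= 4 * `|Z - q|.
  apply: bd.
    by apply: mulr_ge0; [apply: mulr_ge0 => //; exact: mulr_ge0|exact: addr_ge0].
  have : alpha * (k * (1 - k)) <= 1 by rewrite mulr_ile1.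
  have : 0 <= alpha * (k * (1 - k)) by rewrite mulr_ge0.
  by set y := alpha * _ => y0 y1; rewrite -(mulrA 2) -/y; nra.
have b3 : `|2 * (k * (1 - k)) * M2| <= 2 * `|M2|.
  by apply: bd; rewrite ?mulr_ge0//; lra.
have b4 := bd _ (Z - q) 1 k20 k21.
have b5 := bd _ M1 1 k20 k21.
have b6 : `|Z + k * M1 - q| <= `|Z - q| + 1 * `|M1|.
  by rewrite addrAC (le_trans (ler_normD _ _))// lerD2l bd.
have := ler_normD ((1 - k) * (1 + (1 - 2 * alpha) * k) * (S - (x + q ^+ 2))
    + 2 * alpha * (k * (1 - k)) * (Z + q) * (Z - q)
    + 2 * (k * (1 - k)) * M2 + k ^+ 2 * (Z - q)) (k ^+ 2 * M1).
have := ler_normD ((1 - k) * (1 + (1 - 2 * alpha) * k) * (S - (x + q ^+ 2))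
    + 2 * alpha * (k * (1 - k)) * (Z + q) * (Z - q)
    + 2 * (k * (1 - k)) * M2) (k ^+ 2 * (Z - q)).
have := ler_normD ((1 - k) * (1 + (1 - 2 * alpha) * k) * (S - (x + q ^+ 2))
    + 2 * alpha * (k * (1 - k)) * (Z + q) * (Z - q)) (2 * (k * (1 - k)) * M2).
have := ler_normD ((1 - k) * (1 + (1 - 2 * alpha) * k) * (S - (x + q ^+ 2)))
    (2 * alpha * (k * (1 - k)) * (Z + q) * (Z - q)).
have := normr_ge0 (S - (x + q ^+ 2)); lra.
Qed.

(** The constant grows with [t], but the time is fixed while [N] tends to
    infinity. *)
Lemma deviation_avg t : exists K : R, forall N, (0 < N)%N ->
  havg N t (deviation N) <= K / Num.sqrt N%:R.
Proof.
elim: t => [|t [K IH]].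
  exists 0 => N N0; rewrite mul0r /= /deviation /urn_mean_sqr /urn_mean.
  have f0 i : frac [::] i = q by rewrite /urn_frac /fraction/= add0n.
  have -> : \sum_(i < N) frac [::] i = \sum_(i < N) q by apply: eq_bigr.
  have -> : \sum_(i < N) frac [::] i ^+ 2 = \sum_(i < N) q ^+ 2.
    by apply: eq_bigr => i _; rewrite f0.
  by rewrite !mean_cst//= add0r !subrr normr0 addr0.
exists (6 * K + 4) => N N0 /=.
pose r : R := (Num.sqrt N%:R)^-1.
apply: (@le_trans _ _ (havg N t (fun h => 6 * deviation N h + 4 * r))); last first.
  rewrite (hist_avg_comb a b alpha01 N t 6 4 (deviation N) (fun=> r)) hist_avg_cst// [leRHS]mulrDl lerD// -mulrA ler_wpM2l//; exact: IH.
apply: hist_avg_le => // h ht.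
apply: (@le_trans _ _ (bern_avg (probs N h) (fun z => 6 * deviation N h
    + 2 * (1 * `|noise N h (fun=> 1) z| + 1 * `|noise N h (frac h) z|)))).
  apply: bern_avg_le; first exact: urn_probs01.
  by move=> z; rewrite !mul1r; exact: deviation_cons.
rewrite (bern_avg_comb _ 6 2 (fun=> deviation N h)) bern_avg_cst lerD2l bern_avg_comb !mul1r.
have p01 i := urn_prob01 a b alpha01 N h i.
have l1 : bern_avg (probs N h) (fun z => `|noise N h (fun=> 1) z|) <= r.
  by apply: bern_avg_lln => // i; rewrite normr1.
have l2 : bern_avg (probs N h) (fun z => `|noise N h (frac h) z|) <= r.
  apply: bern_avg_lln => // i; have /andP[f0 f1] := urn_frac01 (R := R) a b h i.
  by rewrite ger0_norm.
lra.
Qed.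

(** * Increments of the total fraction *)

(** The variance of the next increment, conditionally on the history. *)
Definition round_variance (N : nat) (h : seq (seq bool)) : R :=
  (nn (size h))^-1 ^+ 2 * (N%:R^-1 * \sum_(i < N) prob N h i * (1 - prob N h i)).

Lemma round_varianceE N h : (0 < N)%N -> round_variance N h =
  (nn (size h))^-1 ^+ 2 * (mean N h - (1 - (1 - alpha) ^+ 2) * mean N h ^+ 2
     - (1 - alpha) ^+ 2 * urn_mean_sqr N h).
Proof.
move=> N0; rewrite /round_variance; congr (_ * _).
under eq_bigr do rewrite mulrBr mulr1 -expr2.
by rewrite sumrB mulrBr mean_prob// mean_prob_sqr//; ring.
Qed.

Lemma round_variance_bound N h : 0 <= round_variance N h <= 1.
Proof.
have n1 : 1 <= nn (size h) := time_ge1 a b (size h).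
set k := (nn (size h))^-1.
have k0 : 0 <= k by rewrite invr_ge0 (le_trans _ n1).
have k1 : k <= 1 by rewrite invf_le1// (lt_le_trans _ n1).
have [i|m0 m1] := andP (mean01 N (f := fun i => prob N h i * (1 - prob N h i)) _).
  have /andP[p0 p1] := urn_prob01 a b alpha01 N h i.
  by rewrite mulr_ge0 ?mulr_ile1 ?subr_ge0// lerBlDr lerDl.
rewrite /round_variance -/k mulr_ge0 ?sqr_ge0//=.
by rewrite mulr_ile1 ?sqr_ge0// expr_le1.
Qed.

(** Both variances are the same Lipschitz polynomial, evaluated at the empirical
    and at the limit moments. *)
Lemma round_variance_dist N h : (0 < N)%N ->
  `|round_variance N h - sigma2 a b alpha (size h)| <= 3 * deviation N h.
Proof.
move=> N0; rewrite round_varianceE// sigma2E -/q /deviation.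
set k := (nn (size h))^-1.
have n1 : 1 <= nn (size h) := time_ge1 a b (size h).
have k0 : 0 <= k by rewrite invr_ge0 (le_trans _ n1).
have k1 : k <= 1 by rewrite invf_le1// (lt_le_trans _ n1).
have k21 : k ^+ 2 <= 1 by rewrite expr_le1.
have /andP[al0 al1] := alpha01.
set Z := mean N h; set S := urn_mean_sqr N h; set x := x_ (size h).
have /andP[Z0 Z1] : 0 <= Z <= 1 by apply: mean01 => i; exact: urn_frac01.
have /andP[q0 q1] : 0 <= q <= 1 by exact: start_fraction01.
set B := (1 - alpha) ^+ 2.
have B0 : 0 <= B := sqr_ge0 _.
have B1 : B <= 1 by rewrite expr_le1//; lra.
rewrite -mulrBr normrM (ger0_norm (sqr_ge0 k)).
apply: (@le_trans _ _ (1 * `|Z - (1 - B) * Z ^+ 2 - B * S - (q - q ^+ 2 - B * x)|)).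
  by rewrite ler_wpM2r.
rewrite mul1r.
have -> : Z - (1 - B) * Z ^+ 2 - B * S - (q - q ^+ 2 - B * x) =
  (Z - q) - (1 - B) * (Z + q) * (Z - q) - B * (S - (x + q ^+ 2)) by ring.
have b1 : `|(1 - B) * (Z + q) * (Z - q)| <= 2 * `|Z - q|.
  rewrite normrM ler_wpM2r// ger0_norm; first by nra.
  by apply: mulr_ge0; [rewrite subr_ge0|exact: addr_ge0].
have b2 : `|B * (S - (x + q ^+ 2))| <= 1 * `|S - (x + q ^+ 2)|.
  by rewrite normrM ler_wpM2r// ger0_norm.
have := ler_normB (Z - q - (1 - B) * (Z + q) * (Z - q)) (B * (S - (x + q ^+ 2))).
have := ler_normB (Z - q) ((1 - B) * (Z + q) * (Z - q)).
have := normr_ge0 (S - (x + q ^+ 2)); lra.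
Qed.

Definition increment (N : nat) (z : seq bool) (h : seq (seq bool)) : R :=
  Num.sqrt N%:R * (mean N (z :: h) - mean N h).

Let step (N : nat) (h : seq (seq bool)) : R :=
  Num.sqrt N%:R * (nn (size h))^-1 * N%:R^-1.

Lemma incrementE N z h : (0 < N)%N -> increment N z h =
  \sum_(i < N) step N h * ((nth false z i)%:R - prob N h i).
Proof.
move=> N0; rewrite /increment urn_mean_cons// addrAC subrr add0r /noise -mulr_sumr.
by rewrite mul1r -mulr_sumr /step !mulrA.
Qed.

Lemma step_sqr_sum N h : (0 < N)%N ->
  \sum_(i < N) step N h ^+ 2 * (prob N h i * (1 - prob N h i)) = round_variance N h.
Proof.
move=> N0; rewrite -mulr_sumr /round_variance mulrA; congr (_ * _).
have n0 : nn (size h) != 0 by rewrite pnatr_eq0 addn1.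
have N1 : N%:R != 0 :> R by rewrite pnatr_eq0 -lt0n.
rewrite /step !exprMn sqr_sqrtr//; move: (nn (size h)) n0 => n n0.
by field; rewrite n0 N1.
Qed.

Lemma increment_variance N h : (0 < N)%N ->
  bern_avg (probs N h) (fun z => increment N z h ^+ 2) = round_variance N h.
Proof.
move=> N0; under eq_bern_avg do rewrite incrementE//.
by apply: etrans (bern_avg_variance N (fun=> step N h) (prob N h)) _; exact: step_sqr_sum.
Qed.

(** A round has [N] bits scaled by at most [1 / sqrt N], whose third powers sum
    to at most [1 / sqrt N]. *)
Lemma increment_clt C g N h : (0 < N)%N -> test_function g -> smooth C g ->
  `|bern_avg (probs N h) (fun z => g (increment N z h))
    - gauss_avg (round_variance N h) g 0|
  <= C * (1 + normal_abs3) / Num.sqrt N%:R.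
Proof.
move=> N0 tg sg; under eq_bern_avg do rewrite incrementE//.
have C0 : 0 <= C by case: sg => g1 [g2 [_ _ /(_ 0)]]; exact: taylor_at_ge0.
have NR : 0 < N%:R :> R by rewrite ltr0n.
have r0 : 0 < Num.sqrt N%:R :> R by rewrite sqrtr_gt0.
have n1 : 1 <= nn (size h) := time_ge1 a b (size h).
have k0 : 0 <= (nn (size h))^-1 by rewrite invr_ge0 (le_trans _ n1).
have k1 : (nn (size h))^-1 <= 1 by rewrite invf_le1// (lt_le_trans _ n1).
have s0 : 0 <= step N h by rewrite !mulr_ge0 ?invr_ge0 ?(ltW r0)// ltW.
rewrite (bern_avg_mkseq N (fun=> step N h) (prob N h)).
pose l := mkseq (fun i => (step N h, prob N h i)) N.
have := lindeberg (l := l) 0 tg sg.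
rewrite /l !sum_mkseq /= step_sqr_sum// => H.
apply: le_trans (H _) _.
  by move=> cp /mapP[i _ ->] /=; split => //; exact: urn_prob01.
rewrite ler_wpM2l ?mulr_ge0 ?addr_ge0 ?normal_abs3_ge0//.
rewrite sumr_const card_ord -[_ *+ N]mulr_natr.
set r := Num.sqrt N%:R in r0 *.
have NE : N%:R = r ^+ 2 by rewrite sqr_sqrtr// ltW.
have -> : step N h ^+ 3 * N%:R = (nn (size h))^-1 ^+ 3 * r^-1.
  have n0 : nn (size h) != 0 by rewrite pnatr_eq0 addn1.
  rewrite /step -/r NE; move: (nn (size h)) n0 => n n0.
  by field; rewrite n0 gt_eqF.
by rewrite ler_piMl ?invr_ge0 ?(ltW r0)// exprn_ile1.
Qed.

Fixpoint increments_prod (g : nat -> R -> R) (N : nat) (h : seq (seq bool)) : R :=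
  if h is z :: h' then increments_prod g N h' * g (size h') (increment N z h') else 1.

Lemma increments_prod01 g N h : (forall k, test_function (g k)) ->
  0 <= increments_prod g N h <= 1.
Proof.
move=> tg; elim: h => [|z h /andP[p0 p1]] /=; first by rewrite ler01 lexx.
have /andP[g0 g1] := (tg (size h)).2 (increment N z h).
by rewrite mulr_ge0//= mulr_ile1.
Qed.

(** Conditionally on the first [t] rounds, the last factor is close to its
    Gaussian average at the random variance [round_variance] by [increment_clt],
    hence to the one at [sigma2 t] by [gauss_avg_lipschitz] and [deviation_avg].
    The latter is a constant and factors out of the expectation. *)
Lemma increments_prod_avg (g : nat -> R -> R) t :
  (forall k, test_function (g k)) -> (forall k, exists C, smooth C (g k)) ->
  exists K : R, forall N, (0 < N)%N ->
  `|havg N t (increments_prod g N)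
    - \prod_(k < t) gauss_avg (sigma2 a b alpha k) (g k) 0| <= K / Num.sqrt N%:R.
Proof.
move=> tg sg; elim: t => [|t [K IH]].
  by exists 0 => N N0 /=; rewrite big_ord0 subrr normr0 mul0r.
have [C sC] := sg t; have [K' dev] := deviation_avg t.
have C0 : 0 <= C by case: sC => g1 [g2 [_ _ /(_ 0)]]; exact: taylor_at_ge0.
pose G := gauss_avg (sigma2 a b alpha t) (g t) 0.
pose L := 1 + C + C * normal_abs3.
have L0 : 0 <= L by rewrite !addr_ge0// mulr_ge0// normal_abs3_ge0.
exists (C * (1 + normal_abs3) + L * (3 * K') + K) => N N0.
rewrite big_ord_recr/= -/G; set Pi := \prod_(k < t) _ in IH *.
pose r : R := (Num.sqrt N%:R)^-1.
have r0 : 0 <= r by rewrite invr_ge0 sqrtr_ge0.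
pose Bh h := bern_avg (probs N h) (fun z => g (size h) (increment N z h)).
have -> : havg N t (fun h => bern_avg (probs N h)
    (fun z => increments_prod g N h * g (size h) (increment N z h))) =
    havg N t (fun h => 1 * (increments_prod g N h * (Bh h - G)) + G * increments_prod g N h).
  apply: eq_hist_avg => // h _; rewrite /Bh.
  have := bern_avg_comb (probs N h) (increments_prod g N h) 0
    (fun z => g (size h) (increment N z h)) (fun=> 0).
  by under eq_bern_avg do rewrite mulr0 addr0; move=> ->; ring.
rewrite hist_avg_comb// mul1r.
have G1 : `|G| <= 1.
  have /andP[G0 G1] := (gauss_avg_test (sigma2 a b alpha t) (tg t)).2 0.
  by rewrite ger0_norm.
have bound : `|havg N t (fun h => increments_prod g N h * (Bh h - G))| <=
    (C * (1 + normal_abs3) + L * (3 * K')) * r.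
  apply: (le_trans (hist_avg_norm _ _ _ _ _ _)) => //.
  apply: (@le_trans _ _ (havg N t (fun h => 1 * (C * (1 + normal_abs3) * r)
      + (L * 3) * deviation N h))).
    apply: hist_avg_le => // h ht.
    have /andP[p0 p1] := increments_prod01 N h tg.
    rewrite normrM (ger0_norm p0) mul1r.
    apply: (@le_trans _ _ `|Bh h - G|); first by rewrite ler_piMl.
    rewrite -ht in sC *.
    have H1 := increment_clt h N0 (tg (size h)) sC.
    have H2 := gauss_avg_lipschitz 0 (tg (size h)) sC (round_variance_bound N h)
       (sigma2_bound b a_gt0 alpha01 (size h)).
    have H3 := round_variance_dist h N0.
    rewrite /G -ht.
    apply: (le_trans (ler_distD (gauss_avg (round_variance N h) (g (size h)) 0) _ _)).
    rewrite lerD// (le_trans H2)// -/L -mulrA ler_wpM2l//.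
  rewrite (hist_avg_comb a b alpha01 N t 1 (L * 3) (fun=> C * (1 + normal_abs3) * r)).
  rewrite hist_avg_cst// mul1r [leRHS]mulrDl lerD2l.
  by rewrite -!mulrA ler_wpM2l// ler_wpM2l// dev.
have -> : (C * (1 + normal_abs3) + L * (3 * K') + K) / Num.sqrt N%:R =
   (C * (1 + normal_abs3) + L * (3 * K')) * r + 1 * (K * r) by rewrite /r; ring.
rewrite -addrA (mulrC Pi) -mulrBr (le_trans (ler_normD _ _))// lerD//.
by rewrite normrM ler_pM// IH.
Qed.

Lemma increment_sqr_avg t N : (0 < N)%N ->
  havg N t.+1 (fun h => increment N (head [::] h) (behead h) ^+ 2) <= 1.
Proof.
move=> N0 /=; rewrite -[leRHS](hist_avg_cst a b alpha01 N t).
apply: hist_avg_le => // h _; rewrite increment_variance//.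
by case/andP: (round_variance_bound N h).
Qed.

End urn_limit.

(** * Continuous functions of sequences *)

Section product_space.
Context {R : realType}.
Implicit Types (F : {ptws nat -> R} -> R) (x y z : nat -> R).

(** Otherwise a sequence of counterexamples, closer and closer to [x] on more
    and more coordinates, would converge to [x] pointwise without convergence of
    [F]. *)
Lemma ptws_continuous_modulus F x (e : R) : continuous F -> 0 < e ->
  exists n : nat, exists2 d : R, 0 < d &
    forall z, (forall k, (k < n)%N -> `|x k - z k| < d) -> `|F x - F z| < e.
Proof.
move=> cF e0; apply: contrapT => H.
have H' (n : nat) : exists z : nat -> R, (forall k, (k < n)%N -> `|x k - z k| < n.+1%:R^-1) /\
    e <= `|F x - F z|.
  apply: contrapT => Hn; apply: H; exists n, n.+1%:R^-1; first by rewrite invr_gt0.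
  move=> z xz; rewrite ltNge; apply/negP => ez.
  by apply: Hn; exists z.
have [z Hz] := choice H'.
have zx : (z : nat -> {ptws nat -> R}) @ \oo --> (x : {ptws nat -> R}).
  apply/(@pointwise_cvgP nat R (z @ \oo) x) => t.
  suff : z^~ t @ \oo --> x t by [].
  apply/cvgrPdist_lt => d d0.
  near=> n; rewrite /=.
  apply: lt_trans ((Hz n).1 t _) _; first by near: n; exact: nbhs_infty_gt.
  by near: n; exact: near_infty_natSinv_lt (PosNum d0).
have /cvgrPdist_lt /(_ e e0) [n _ /(_ n (leqnn n)) /=] := cvg_comp (z : nat -> {ptws nat -> R}) F zx (cF x).
by apply/negP; rewrite -leNgt; exact: (Hz n).2.
Unshelve. all: by end_near. Qed.

Lemma coord_cvg x k :
  (fun z : {ptws nat -> R} => z k : R) @ (x : {ptws nat -> R}) --> (x k : R).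
Proof.
have pc : {ptws, nbhs (x : {ptws nat -> R}) --> (x : nat -> R)} by [].
exact: (@pointwise_cvgP nat R (nbhs (x : {ptws nat -> R})) x
  (nbhs_filter (x : {ptws nat -> R}))).1 pc k.
Qed.

(** These are the perturbations made by rounding to a grid on the first [q]
    coordinates, of mesh [1 / q.+1] and range about [q]: an error of a few
    meshes for a coordinate inside the range, and no control outside it or
    beyond the first [q] coordinates. *)
Definition insensitive F (e : R) (q : nat) x := forall y,
  (forall k, (k < q)%N -> `|x k| <= q%:R -> `|x k - y k| <= 4 / q.+1%:R) ->
  `|F x - F y| <= e.

(** Each point has a modulus of continuity that involves finitely many
    coordinates; compactness makes one [q] suit all the points. *)
Lemma near_insensitive F (e : R) (K : set {ptws nat -> R}) : continuous F ->
  0 < e -> compact K -> \forall q \near \oo, K `<=` insensitive F e q.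
Proof.
move=> cF e0 /compact_near_coveringP; apply => x _.
have e20 : 0 < e / 2 by rewrite divr_gt0.
have [n [d d0 H]] := ptws_continuous_modulus x cF e20.
have d20 : 0 < d / 2 by rewrite divr_gt0.
have nx : nbhs (x : {ptws nat -> R})
    [set x' : {ptws nat -> R} | forall k, (k < n)%N -> `|x k - x' k| < d / 2].
  have : nbhs (x : {ptws nat -> R})
      [set x' : {ptws nat -> R} | forall k : 'I_n, `|x k - x' k| < d / 2].
    apply: (@filter_forall _ 'I_n
      (fun (k : 'I_n) (x' : {ptws nat -> R}) => `|x k - x' k| < d / 2)
      (nbhs (x : {ptws nat -> R}))) => k.
    have nb : nbhs (x k : R) [set y : R | `|x k - y| < d / 2].
      exact: (nbhsx_ballx (x k : R) (d / 2) d20).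
    exact: (@coord_cvg x k _ nb).
  by apply: filterS => x' Hx' k kn; exact: (Hx' (Ordinal kn)).
have nq : \forall q \near \oo, [/\ (n <= q)%N, 4 / q.+1%:R < d / 2 &
    forall k, (k < n)%N -> `|x k| + d <= q%:R].
  pose m := \sum_(k < n) `|x k| + d.
  near=> q; split.
  - by near: q; exact: nbhs_infty_ge.
  - rewrite ltr_pdivrMr// mulrC -ltr_pdivrMr//.
    apply: (@lt_trans _ _ q%:R); last by rewrite ltr_nat.
    by near: q; exact: nbhs_infty_gtr.
  - move=> k kn; apply: (@le_trans _ _ m).
      by rewrite lerD2r (bigD1 (Ordinal kn))//= lerDl sumr_ge0.
    by near: q; exact: nbhs_infty_ger.
exists ([set x' : {ptws nat -> R} | forall k, (k < n)%N -> `|x k - x' k| < d / 2],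
  [set q : nat | [/\ (n <= q)%N, 4 / q.+1%:R < d / 2 &
    forall k, (k < n)%N -> `|x k| + d <= q%:R]]) => /=; first by split; [exact: nx|exact: nq].
move=> [x' q] /= [Hx' [nq' qd qx]] y Hy.
have -> : F x' - F y = (F x - F y) - (F x - F x') by ring.
have h1 : `|F x - F x'| < e / 2.
  by apply: H => k kn; apply: lt_trans (Hx' k kn) _; rewrite ltr_pdivrMr// ltr_pMr// ltr1n.
have h2 : `|F x - F y| < e / 2.
  apply: H => k kn; have x'k := Hx' k kn.
  have : `|x' k| <= q%:R.
    rewrite (le_trans _ (qx k kn))//.
    have -> : x' k = x k - (x k - x' k) by ring.
    by rewrite (le_trans (ler_normB _ _))// lerD2l (le_trans (ltW x'k))// ler_pdivrMr// ler_pMr// ler1n.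
  move=> /(Hy k (leq_trans kn nq')) x'y.
  have -> : x k - y k = (x k - x' k) + (x' k - y k) by ring.
  rewrite (le_lt_trans (ler_normD _ _))// [ltRHS]splitr.
  exact: ltrD x'k (le_lt_trans x'y qd).
rewrite (le_trans (ler_normB _ _))// [leRHS]splitr.
exact: lerD (ltW h2) (ltW h1).
Unshelve. all: by end_near. Qed.

Lemma compact_box (M : nat -> R) : compact [set x : {ptws nat -> R} | forall k, `|x k| <= M k].
Proof.
have := @tychonoff nat (fun=> R) (fun k => `[- M k, M k]%classic)
  (fun k => @segment_compact R (- M k) (M k)).
congr compact; apply/seteqP; split => x /= H k.
  by have := H k; rewrite /= in_itv/= ler_norml.
by rewrite /= in_itv/= -ler_norml.
Qed.

End product_space.

(** * Smooth partitions of unity on a grid *)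

Section grid_approximation.
Context {R : realType}.

Lemma smooth_cst (c : R) : smooth 0 (fun=> c).
Proof.
exists (fun=> 0), (fun=> 0); split => // x h.
by rewrite !mul0r !subr0 subrr normr0.
Qed.

Definition grid_size (q : nat) : nat := (2 * ((q + 4) * q.+1))%N.

Definition grid_point (q j : nat) : R := j%:R / q.+1%:R - (q + 4)%:R.

(** The ramps decrease in [j] from the constant 1 to the constant 0, so that
    their successive differences sum to 1 ([sum_bump]). *)
Definition ramp (q j : nat) (x : R) : R :=
  if j == 0%N then 1 else if (grid_size q < j)%N then 0 else
  smooth_step (((q + 4) * q.+1)%:R - j%:R + q.+1%:R * x).

Definition bump (q j : nat) (x : R) : R := ramp q j x - ramp q j.+1 x.

Lemma ramp01 q j x : 0 <= ramp q j x <= 1.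
Proof.
rewrite /ramp; case: ifP => _; first by rewrite ler01 lexx.
by case: ifP => _; [rewrite lexx ler01|exact: smooth_step01].
Qed.

Lemma ramp_decr q j x : ramp q j.+1 x <= ramp q j x.
Proof.
have /andP[r0 r1] := ramp01 q j.+1 x; have /andP[s0 s1] := ramp01 q j x.
have [j0|j0] := eqVneq j 0%N.
  by rewrite j0 in r1 *; rewrite (_ : ramp q 0 x = 1)// /ramp eqxx.
have [jL|jL] := ltnP (grid_size q) j.+1; first by rewrite {1}/ramp /= jL.
rewrite /ramp /= (negbTE j0) ltnNge jL /= ltnNge (ltnW jL)/=.
rewrite -natr1 (_ : _ + _ = ((q + 4) * q.+1)%:R - j%:R + q.+1%:R * x - 1); last by ring.
exact: smooth_step_shift_le.
Qed.

Lemma bump01 q j x : 0 <= bump q j x <= 1.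
Proof.
rewrite /bump subr_ge0 ramp_decr/=.
have /andP[r0 r1] := ramp01 q j.+1 x; have /andP[s0 s1] := ramp01 q j x; lra.
Qed.

Lemma smooth_ramp q j : exists C, smooth C (ramp q j).
Proof.
rewrite /ramp; case: (j == 0%N); first by exists 0; exact: smooth_cst.
case: (grid_size q < j)%N; first by exists 0; exact: smooth_cst.
have [C SC] := @smooth_step_smooth R.
by eexists; exact: smooth_affine SC.
Qed.

Lemma measurable_ramp q j : measurable_fun setT (ramp q j).
Proof.
rewrite /ramp; case: (j == 0%N); first exact: measurable_cst.
case: (grid_size q < j)%N; first exact: measurable_cst.
exact: (measurable_test_affine _ _ measurable_smooth_step).
Qed.

Lemma smooth_bump q j : exists C, smooth C (bump q j).
Proof.
have [C S] := smooth_ramp q j; have [C' S'] := smooth_ramp q j.+1.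
eexists; have := smooth_comb 1 (-1) S S'; congr smooth.
by apply/funext => x; rewrite mul1r mulN1r.
Qed.

Lemma bump_test q j : test_function (bump q j).
Proof. by split; [apply: measurable_funB; exact: measurable_ramp|exact: bump01]. Qed.

Lemma sum_bump q x : \sum_(j < (grid_size q).+1) bump q j x = 1.
Proof.
have := telescope_sumr (fun j => - ramp q j x) (leq0n (grid_size q).+1).
rewrite big_mkord /=; under eq_bigr do rewrite opprK addrC -/(bump q _ x).
by move=> ->; rewrite /ramp eqxx ltnS leqnn oppr0 opprK add0r.
Qed.

(** A ramp changes only within three meshes after its starting point. The first
    and the last bump, which collect everything beyond the grid, vanish between
    [-q] and [q] because the grid extends 4 units further. *)
Lemma bump_support q j x : `|x| <= q%:R -> bump q j x != 0 ->
  `|x - grid_point q j| <= 4 / q.+1%:R.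
Proof.
rewrite ler_norml => /andP[qx xq].
have s0 : 0 < q.+1%:R :> R by rewrite ltr0n.
set s := q.+1%:R in s0 *.
have xE : x - grid_point q j = (((q + 4) * q.+1)%:R - j%:R + s * x) / s.
  by rewrite /grid_point natrM -/s; field; rewrite gt_eqF.
apply: contraNT; rewrite -ltNge xE normrM (gtr0_norm (x := s^-1)) ?invr_gt0//.
rewrite ltr_pM2r ?invr_gt0//; set y := _ + _ * x => y4.
have y0 : s * (x + q%:R) + 4 * s - j%:R = y by rewrite /y natrM natrD -/s; ring.
have xs : 0 <= s * (x + q%:R) by apply: mulr_ge0; [exact: ltW|lra].
have s1 : 1 <= s by rewrite ler1n.
have L0 : (0 < grid_size q)%N by rewrite /grid_size !muln_gt0 addn_gt0 orbT.
have rampE i : (0 < i)%N -> (i <= grid_size q)%N ->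
    ramp q i x = smooth_step (y + j%:R - i%:R).
  move=> i0 iL; rewrite /ramp gtn_eqF// ltnNge iL /=.
  by congr smooth_step; rewrite /y -/s; ring.
rewrite /bump; have [jE|j0] := eqVneq j 0%N.
  have -> : ramp q j x = 1 by rewrite /ramp jE eqxx.
  rewrite rampE ?jE// smooth_step_ge3 ?subrr//.
  by move: y0; rewrite jE => y0; lra.
have [jL|jL] := ltnP (grid_size q) j.
  have rz i : (grid_size q < i)%N -> ramp q i x = 0.
    by move=> iL; rewrite /ramp gtn_eqF ?iL// (leq_trans _ iL).
  by rewrite !rz ?subrr// ltnS ltnW.
rewrite [ramp q j x]rampE ?lt0n// addrK.
have [jL'|jL'] := ltnP (grid_size q) j.+1.
  have -> : ramp q j.+1 x = 0 by rewrite /ramp /= jL'.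
  rewrite smooth_step_le0 ?subrr//.
  have jE : j%:R = 2 * (q%:R + 4) * s :> R.
    rewrite (_ : j = grid_size q); last by apply/eqP; rewrite eqn_leq jL -ltnS jL'.
    by rewrite /grid_size !natrM natrD mulrA.
  have : 0 <= s * (q%:R - x) by apply: mulr_ge0; [exact: ltW|lra].
  by move: y0; rewrite jE; lra.
rewrite rampE// -natr1 (_ : y + _ - _ = y - 1); last by ring.
have [y_ge0|y_lt0] := leP 0 y.
  rewrite ger0_norm// in y4.
  by rewrite !smooth_step_ge3 ?subrr//; lra.
by rewrite !smooth_step_le0 ?subrr//; lra.
Qed.

Definition grid (q : nat) (j : {ffun 'I_q -> 'I_(grid_size q).+1}) (k : nat) : R :=
  if insub k is Some i then grid_point q (j i) else 0.

Definition grid_weight (q : nat) (j : {ffun 'I_q -> 'I_(grid_size q).+1})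
    (x : nat -> R) : R :=
  \prod_(k < q) bump q (j k) (x k).

Definition grid_approx (F : (nat -> R) -> R) (q : nat) (x : nat -> R) : R :=
  \sum_(j : {ffun 'I_q -> 'I_(grid_size q).+1}) F (grid j) * grid_weight j x.

Lemma grid_weight01 q (j : {ffun 'I_q -> 'I_(grid_size q).+1}) x :
  0 <= grid_weight j x <= 1.
Proof.
rewrite /grid_weight; elim/big_ind : _ => [|u v /andP[u0 u1] /andP[v0 v1]|k _].
- by rewrite ler01 lexx.
- by rewrite mulr_ge0//= mulr_ile1.
- exact: bump01.
Qed.

Lemma sum_grid_weight q x :
  \sum_(j : {ffun 'I_q -> 'I_(grid_size q).+1}) grid_weight j x = 1.
Proof.
rewrite /grid_weight -(bigA_distr_bigA (fun (k : 'I_q) (i : 'I_(grid_size q).+1) => bump q i (x k))).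
by rewrite big1// => k _; exact: sum_bump.
Qed.

(** The weights sum to 1, and those that do not vanish at [x] belong to grid
    points to which [F] does not distinguish [x]. *)
Lemma grid_approx_dist (F : {ptws nat -> R} -> R) q x (e : R) :
  insensitive F e q x -> `|F x - grid_approx F q x| <= e.
Proof.
move=> H; rewrite /grid_approx -[F x]mulr1 -(sum_grid_weight q x) mulr_sumr -sumrB.
rewrite (le_trans (ler_norm_sum _ _ _))// -[leRHS]mulr1 -(sum_grid_weight q x) mulr_sumr.
apply: ler_sum => j _; rewrite -mulrBl normrM.
have /andP[w0 _] := grid_weight01 j x; rewrite (ger0_norm w0).
have [->|wn0] := eqVneq (grid_weight j x) 0; first by rewrite !mulr0.
rewrite ler_wpM2r//; apply: H => k kq xk.
rewrite /grid (insubT (fun i => i < q)%N kq); apply: bump_support => //.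
by move: wn0 => /prodf_neq0 /(_ (Sub k kq) isT).
Qed.

Lemma grid_approx_bound F q x (M : R) : (forall y, `|F y| <= M) ->
  `|grid_approx F q x| <= M.
Proof.
move=> FM; rewrite (le_trans (ler_norm_sum _ _ _))// -[leRHS]mulr1 -(sum_grid_weight q x) mulr_sumr.
apply: ler_sum => j _; have /andP[w0 _] := grid_weight01 j x.
by rewrite normrM (ger0_norm w0) ler_wpM2r.
Qed.

End grid_approximation.

(** * Weak convergence from products of test functions *)

Section bounded_expectation.
Context {R : realType} (d : measure_display) (T : measurableType d)
  (P : probability T R).

Lemma integrable_bounded (f : T -> R) (C : R) : measurable_fun setT f ->
  (forall w, `|f w| <= C) -> P.-integrable setT (EFin \o f).
Proof.
move=> mf fC.
apply: (le_integrable measurableT _ _ (integrable_cst_prob P `|C|)).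
  exact/measurable_EFinP.
by move=> x _ /=; rewrite lee_fin normr_id (le_trans (fC x))// ler_norm.
Qed.

Lemma expectation_Rintegral (f : T -> R) : P.-integrable setT (EFin \o f) ->
  ('E_P[f] = (\int[P]_w f w)%:E)%E.
Proof. by move=> fi; rewrite unlock /Rintegral fineK//; exact: integrable_fin_num. Qed.

Lemma Rintegral_dist (f g : T -> R) (C e : R) (B : set T) :
  measurable_fun setT f -> measurable_fun setT g ->
  (forall w, `|f w| <= C) -> (forall w, `|g w| <= C) -> measurable B -> 0 <= e ->
  (P B <= e%:E)%E -> (forall w, ~ B w -> `|f w - g w| <= e) ->
  `|\int[P]_w f w - \int[P]_w g w| <= e + 2 * C * e.
Proof.
move=> mf mg fC gC mB e0 PB fg.
have fi := integrable_bounded mf fC; have gi := integrable_bounded mg gC.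
have C0 : 0 <= C.
  have [w|w] := pselect (exists w : T, True).
    by case: w => w _; rewrite (le_trans _ (fC w)).
  have T0 : [set: T] = set0 by apply/seteqP; split => // w' _; apply: w; exists w'.
  by have := @probability_setT _ _ _ P; rewrite T0 measure0 => /eqP; rewrite lt_eqF// lte01.
have bi : P.-integrable setT (EFin \o (fun w => e + 2 * C * \1_B w)).
  apply: integrable_addr; first exact: integrable_cst_prob.
  apply: integrable_mulr; apply: (integrable_bounded (C := 1)).
    exact: measurable_indic.
  by move=> w; rewrite indicE; case: (_ \in _); rewrite ?normr1// normr0.
have fgi : P.-integrable setT (EFin \o (fun w => f w - g w)).
  exact: (integrableB measurableT fi gi).
rewrite -RintegralB//.
apply: (le_trans (le_normr_Rintegral measurableT fgi)).
apply: (@le_trans _ _ (\int[P]_w (e + 2 * C * \1_B w))).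
  apply: le_Rintegral => //; first exact: (integrable_norm fgi).
  move=> w _; rewrite indicE.
  have [wB|wB] := pselect (B w).
    rewrite mem_set// mulr1 (le_trans (ler_normB _ _))//.
    by rewrite (le_trans (lerD (fC w) (gC w)))//; lra.
  by rewrite memNset// mulr0 addr0; exact: fg.
rewrite RintegralD//; last 2 first.
- exact: integrable_cst_prob.
- apply: integrable_mulr; apply: (integrable_bounded (C := 1)).
    exact: measurable_indic.
  by move=> w; rewrite indicE; case: (_ \in _); rewrite ?normr1// normr0.
rewrite Rintegral_cst_prob lerD2l RintegralZl//; last first.
  apply: (integrable_bounded (C := 1)); first exact: measurable_indic.
  by move=> w; rewrite indicE; case: (_ \in _); rewrite ?normr1// normr0.
rewrite ler_wpM2l ?mulr_ge0// /Rintegral integral_indic// setIT.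
by rewrite -lee_fin fineK// fin_num_measure.
Qed.

End bounded_expectation.

Section tightness.
Context {R : realType} (d : measure_display) (T : measurableType d)
  (P : probability T R).
Implicit Types (F : {ptws nat -> R} -> R) (X : nat -> T -> R).

Lemma measurable_grid_approx F q X : (forall k, measurable_fun setT (X k)) ->
  measurable_fun setT (fun w => grid_approx F q (fun k => X k w)).
Proof.
move=> mX; apply: measurable_sum => j; apply: measurable_funM => //.
apply: measurable_prod => k _.
exact: (measurableT_comp (bump_test q (j k)).1 (mX k)).
Qed.

(** A pointwise limit of the grid approximations, which are finite combinations
    of products of measurable functions. *)
Lemma measurable_ptws_comp F X : continuous F ->
  (forall k, measurable_fun setT (X k)) ->
  measurable_fun setT (fun w => F (fun k => X k w)).
Proof.
move=> cF mX.
apply: (measurable_fun_cvg (h := fun q w => grid_approx F q (fun k => X k w))).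
  by move=> q; exact: measurable_grid_approx.
move=> w _; apply/cvgrPdist_le => e e0.
have := near_insensitive cF e0 (@compact_set1 {ptws nat -> R} (fun k => X k w)).
apply: filterS => q H; apply: grid_approx_dist; exact: H.
Qed.

(** The Chebyshev tail bound of a variable of second moment at most 1, at every
    coordinate. *)
Definition tails_le1 X := forall (k : nat) (M : R), 0 < M ->
  (P [set w | (M < `|X k w|)%R] <= (M ^- 2)%:E)%E.

(** The half-widths for which the tail probabilities are at most [e / 2 ^ k.+1],
    of sum [e]. *)
Definition tail_box (e : R) (k : nat) : R := Num.sqrt ((2 ^ k.+1)%:R / e).

Lemma tail_box_prob X (e : R) : (forall k, measurable_fun setT (X k)) ->
  tails_le1 X -> 0 < e ->
  measurable (\bigcup_k [set w | tail_box e k < `|X k w|]) /\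
  (P (\bigcup_k [set w | (tail_box e k < `|X k w|)%R]) <= e%:E)%E.
Proof.
move=> mX tX e0.
have m k : measurable [set w | tail_box e k < `|X k w|].
  have mn : measurable_fun setT (fun w => `|X k w|).
    exact: (measurableT_comp (@normr_measurable R setT) (mX k)).
  rewrite (_ : [set _ | _] = setT `&` (fun w => `|X k w|) @^-1` `]tail_box e k, +oo[%classic).
    exact: mn.
  by rewrite setTI; apply/seteqP; split => w /=; rewrite in_itv/= andbT.
split; first exact: bigcupT_measurable.
apply: (le_trans (generalized_Boole_inequality P m _)).
  exact: bigcupT_measurable.
apply: le_trans (epsilon_trick0 xpredT (ltW e0)).
apply: lee_nneseries => k _ //.
have p0 : 0 < (2 ^ k.+1)%:R / e :> R by rewrite divr_gt0// ltr0n expn_gt0.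
apply: (le_trans (tX k _ _)); first by rewrite sqrtr_gt0.
by rewrite lee_fin sqr_sqrtr ?(ltW p0)// invf_div.
Qed.

Lemma grid_approx_expectation F X (C e : R) q : continuous F ->
  (forall x, `|F x| <= C) -> (forall k, measurable_fun setT (X k)) ->
  tails_le1 X -> 0 < e ->
  [set x : {ptws nat -> R} | forall k, `|x k| <= tail_box e k]
    `<=` insensitive F e q ->
  `|\int[P]_w F (fun k => X k w) - \int[P]_w grid_approx F q (fun k => X k w)|
    <= e + 2 * C * e.
Proof.
move=> cF FC mX tX e0 Hq.
have [mB PB] := tail_box_prob mX tX e0.
apply: (Rintegral_dist _ _ _ _ mB (ltW e0) PB).
- exact: measurable_ptws_comp.
- exact: measurable_grid_approx.
- by move=> w.
- by move=> w; exact: grid_approx_bound.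
- move=> w Bw; apply: grid_approx_dist; apply: Hq => k /=.
  rewrite leNgt; apply/negP => kw; apply: Bw; by exists k.
Qed.

Lemma Rintegral_grid_approx F q X : (forall k, measurable_fun setT (X k)) ->
  \int[P]_w grid_approx F q (fun k => X k w) =
  \sum_(j : {ffun 'I_q -> 'I_(grid_size q).+1})
    F (grid j) * \int[P]_w grid_weight j (fun k => X k w).
Proof.
move=> mX.
have mw j : measurable_fun setT (fun w => grid_weight (q := q) j (fun k => X k w) : R).
  apply: measurable_prod => k _.
  exact: (measurableT_comp (bump_test q (j k)).1 (mX k)).
have iw j : P.-integrable setT (EFin \o (fun w => grid_weight (q := q) j (fun k => X k w) : R)).
  by apply: test_function_integrable => // w; exact: grid_weight01.
rewrite /Rintegral; under eq_integral do rewrite /grid_approx -sumEFin.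
rewrite integral_sum//; last first.
  by move=> j; exact: (integrable_mulr (F (grid j)) (iw j)).
rewrite -sum_fine; last first.
  by move=> j _; apply: integrable_fin_num => //; exact: (integrable_mulr (F (grid j)) (iw j)).
by apply: eq_bigr => j _; exact: (@RintegralZl _ _ _ P setT _ (F (grid j)) measurableT (iw j)).
Qed.

End tightness.

Section weak_convergence.
Context {R : realType} (d d' : measure_display) (T : measurableType d)
  (T' : measurableType d') (P : probability T R) (Q : probability T' R).
Variables (X : nat -> nat -> T -> R) (Y : nat -> T' -> R).
Hypotheses (mX : forall N k, measurable_fun setT (X N k))
  (mY : forall k, measurable_fun setT (Y k)).
Hypotheses (tX : forall N, (0 < N)%N -> tails_le1 P (X N)) (tY : tails_le1 Q Y).
Hypothesis XY : forall (g : nat -> R -> R) n, (forall k, test_function (g k)) ->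
  (forall k, exists C, smooth C (g k)) ->
  \int[P]_w (\prod_(k < n) g k (X N k w)) @[N --> \oo] -->
  \int[Q]_w (\prod_(k < n) g k (Y k w)).

Lemma cvg_grid_approx (F : {ptws nat -> R} -> R) q :
  \int[P]_w grid_approx F q (fun k => X N k w) @[N --> \oo] -->
  \int[Q]_w grid_approx F q (fun k => Y k w).
Proof.
rewrite Rintegral_grid_approx//.
under eq_fun do rewrite Rintegral_grid_approx//.
apply: (cvg_big (@add_continuous R)) => j _; apply: cvgMr.
pose g k := if insub k is Some i then bump q (j i) else bump q 0%N : R -> R.
have gE (i : 'I_q) : g i = bump q (j i) by rewrite /g valK.
have tg k : test_function (g k).
  by rewrite /g; case: insubP => *; exact: bump_test.
have sg k : exists C, smooth C (g k).
  by rewrite /g; case: insubP => *; exact: smooth_bump.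
have wE (x : nat -> R) : grid_weight j x = \prod_(k < q) g k (x k).
  by apply: eq_bigr => k _; rewrite gE.
under eq_Rintegral do rewrite wE.
rewrite (_ : (fun N => \int[P]_w grid_weight j (fun k => X N k w)) =
    (fun N => \int[P]_w \prod_(k < q) g k (X N k w))); last first.
  by apply/funext => N; apply: eq_Rintegral => w _; rewrite wE.
exact: XY.
Qed.

(** A grid approximation is a finite combination of products of test functions,
    so its expectation converges. On the box [tail_box], compact and left with
    small probability uniformly in [N], it is uniformly close to [F]. *)
Theorem product_tests_cvg (F : {ptws nat -> R} -> R) : continuous F ->
  bounded_fun F ->
  ('E_P[fun w => F (fun k => X N k w)] @[N --> \oo] -->
   'E_Q[fun w => F (fun k => Y k w)])%E.
Proof.
move=> cF [M [_ /(_ (Num.max M 0 + 1))]] /=.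
rewrite ltr_pwDr ?le_max ?lexx// => /(_ isT) FC.
set C := Num.max M 0 + 1 in FC.
have C0 : 0 <= C by rewrite addr_ge0// le_max lexx orbT.
have {}FC x : `|F x| <= C by exact: FC.
have iX N : P.-integrable setT (EFin \o (fun w => F (fun k => X N k w))).
  by apply: (integrable_bounded _ (C := C)) => //; exact: measurable_ptws_comp.
have iY : Q.-integrable setT (EFin \o (fun w => F (fun k => Y k w))).
  by apply: (integrable_bounded _ (C := C)) => //; exact: measurable_ptws_comp.
rewrite expectation_Rintegral//.
rewrite (_ : (fun N => _) = (fun N => (\int[P]_w F (fun k => X N k w))%:E)); last first.
  by apply/funext => N; rewrite expectation_Rintegral.
apply: cvg_EFin; first exact: nearW.
apply/cvgrPdist_le => eps eps0 /=.
(* The two grid approximations cost [e + 2 * C * e] each, the comparison of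
   their expectations costs [e]. *)
pose e := eps / (3 + 4 * C).
have d0 : 0 < 3 + 4 * C by rewrite ltr_pwDl// mulr_ge0.
have e0 : 0 < e by rewrite divr_gt0.
have [q _ Hq] := near_insensitive cF e0 (@compact_box R (tail_box e)).
have {}Hq := Hq q (leqnn q).
have HY := grid_approx_expectation cF FC mY tY e0 Hq.
have /cvgrPdist_le /(_ e e0) Hg := @cvg_grid_approx F q.
near=> N.
have N0 : (0 < N)%N by near: N; exact: nbhs_infty_gt.
have HX := grid_approx_expectation cF FC (mX N) (tX N0) e0 Hq.
have HN : `|\int[Q]_w grid_approx F q (fun k => Y k w) -
   \int[P]_w grid_approx F q (fun k => X N k w)| <= e by near: N.
rewrite (_ : eps = (e + 2 * C * e) + (e + (e + 2 * C * e))); last first.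
  by rewrite /e; field; rewrite gt_eqF.
apply: (le_trans (ler_distD (\int[Q]_w grid_approx F q (fun k => Y k w)) _ _)).
rewrite lerD//.
apply: (le_trans (ler_distD (\int[P]_w grid_approx F q (fun k => X N k w)) _ _)).
by rewrite lerD// distrC.
Unshelve. all: by end_near. Qed.

End weak_convergence.

(** * Independence of the noise from its past *)

Section gaussian_noise.
Context {R : realType} (d : measure_display) (T : measurableType d)
  (Q : probability T R) (B : nat -> {RV Q >-> R}).
Hypothesis B_indep : mutually_independent Q (fun t : nat => B t.+1).
Hypothesis B_law : forall t, has_law Q (B t.+1) (normal_prob 0 1).
Local Notation N01 := (@normal_prob R 0 1).

Definition noise_events (t : nat) : set (set T) :=
  [set C | exists k : nat, exists2 A : set R,
     (k < t)%N /\ measurable A & C = B k.+1 @^-1` A].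

(** A separate type for the sigma-algebra of the first [t] noises lets functions
    of the past be handled as ordinary measurable functions on a product with
    the next noise. *)
Definition past (t : nat) := g_sigma_algebraType (noise_events t).

Definition noise_box (t : nat) (A : nat -> set R) : set T :=
  [set w | forall k, (k < t)%N -> A k (B k.+1 w)].

Lemma measurable_noise (t : nat) (A : set R) : measurable A ->
  measurable (B t.+1 @^-1` A).
Proof. by move=> mA; rewrite -[X in measurable X]setTI; exact: measurable_funP. Qed.

Lemma noise_boxE t A : noise_box t A =
  \bigcap_(i in [set` [fset k in iota 0 t]%fset]) (B i.+1 @^-1` A i).
Proof.
apply/seteqP; split => w H k /=.
  by rewrite inE mem_iota => /H.
by move=> kt; apply: H; rewrite /= inE mem_iota.
Qed.

Lemma measurable_noise_box t A : (forall k, measurable (A k)) ->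
  measurable (noise_box t A).
Proof.
move=> mA; rewrite noise_boxE; apply: fin_bigcap_measurable => [|k _].
  exact: finite_fset.
exact: measurable_noise.
Qed.

Lemma noise_box_prob t A : (forall k, measurable (A k)) ->
  Q (noise_box t A) = (\prod_(k < t) Q (B k.+1 @^-1` A k))%E.
Proof.
move=> mA; rewrite noise_boxE B_indep// -(big_mkord xpredT (fun k => Q (B k.+1 @^-1` A k))).
apply: perm_big; apply: uniq_perm; rewrite ?fset_uniq ?iota_uniq//.
by move=> k; rewrite inE /index_iota subn0.
Qed.

(** Boxes form a family stable under intersection that generates the past, and
    both sides are finite measures in [C]. *)
Lemma past_independent t (C : set T) (A : set R) :
  <<s noise_events t >> C -> measurable A ->
  Q (C `&` B t.+1 @^-1` A) = (Q C * Q (B t.+1 @^-1` A))%E.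
Proof.
move=> sC mA; have mE := measurable_noise t mA.
set E := _ @^-1` A in mE *.
pose G := [set D : set T | exists2 A' : nat -> set R, (forall k, measurable (A' k)) &
  D = noise_box t A'].
have GC : <<s G >> C.
  apply: sC; split; first exact: smallest_sigma_algebra.
  move=> _ [k [A' [kt mA'] ->]].
  apply: sub_sigma_algebra.
  exists (fun i => if i == k then A' else setT).
    by move=> i; case: ifP.
  apply/seteqP; split => w /=.
    by move=> Aw i it; case: ifP => // /eqP ->.
  by move=> /(_ k kt); rewrite eqxx.
have QE : Q E \is a fin_num by exact: fin_num_measure.
pose m1 : {measure set T -> \bar R} := mrestr Q mE.
pose m2 : {measure set T -> \bar R} := mscale (NngNum (fine_ge0 (measure_ge0 Q E))) Q.
have m1E D : m1 D = Q (D `&` E) by [].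
have m2E D : m2 D = (Q E * Q D)%E.
  by rewrite -[LHS]/((fine (Q E))%:E * Q D)%E fineK.
have : m1 C = m2 C.
  apply: (g_sigma_algebra_measure_unique G _ (fun=> setT)) => //.
  - by move=> _ [A' mA' ->]; exact: measurable_noise_box.
  - move=> _; exists (fun=> setT) => //.
    by apply/seteqP; split.
  - by apply/seteqP; split => // w _; exists 0%N.
  - move=> _ _ [A1 mA1 ->] [A2 mA2 ->]; exists (fun k => A1 k `&` A2 k).
      by move=> k; exact: measurableI.
    apply/seteqP; split => w /=.
      by move=> [H1 H2] k kt; split; [exact: H1|exact: H2].
    by move=> H; split => k /H [].
  - move=> _ [A' mA' ->]; rewrite m1E m2E.
    pose A2 k := if k == t then A else A' k.
    have -> : noise_box t A' `&` E = noise_box t.+1 A2.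
      apply/seteqP; split => w /=.
        move=> [H1 H2] k; rewrite ltnS leq_eqVlt => /orP[/eqP ->|kt].
          by rewrite /A2 eqxx.
        by rewrite /A2 ltn_eqF//; exact: H1.
      move=> H; split => [k kt|].
        by have := H k (ltnW kt); rewrite /A2 ltn_eqF.
      by have := H t (ltnSn t); rewrite /A2 eqxx.
    rewrite !noise_box_prob//; last by move=> k; rewrite /A2; case: ifP.
    rewrite big_ord_recr/= /A2 eqxx muleC; congr (_ * _)%E.
    by apply: eq_bigr => k _; rewrite ltn_eqF.
  - by move=> k; rewrite m1E setTI ltey_eq QE.
by rewrite m1E m2E muleC.
Qed.

Lemma measurable_to_past t : measurable_fun setT (fun w : T => w : past t).
Proof.
move=> _ C sC; rewrite setTI; apply: sC; split; first exact: sigma_algebra_measurable.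
by move=> _ [k [A [_ mA] ->]]; exact: measurable_noise.
Qed.

Lemma measurable_past_noise t k : (k < t)%N ->
  measurable_fun setT (B k.+1 : past t -> R).
Proof.
move=> kt _ A mA; rewrite setTI; apply: sub_sigma_algebra.
by exists k; exists A.
Qed.

(** The joint law of the past and the next noise is a product measure, as is
    checked on rectangles; the identity is then the Tonelli theorem. *)
Lemma freezing t (psi : past t * measurableTypeR R -> \bar R) : measurable_fun setT psi ->
  (forall p, 0 <= psi p)%E ->
  (\int[Q]_w psi (w, B t.+1 w) = \int[Q]_w \int[N01]_y psi (w, y))%E.
Proof.
move=> mpsi psi0.
have mid := @measurable_to_past t.
pose i_ : {mfun T >-> past t} :=
  HB.pack (fun w : T => w : past t) (isMeasurableFun.Build _ _ _ _ _ mid).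
pose J (w : T) : past t * measurableTypeR R := (w : past t, B t.+1 w).
have mB : measurable_fun setT (B t.+1) by exact: measurable_funP.
have mJ : measurable_fun setT J.
  by apply: measurable_fun_pair; [exact: mid|exact: mB].
pose m1 : probability (past t) R := distribution Q i_.
transitivity (\int[(m1 \x N01)%E]_p psi p)%E.
  have H := ge0_integral_pushforward mJ Q measurableT mpsi (fun y _ => psi0 y).
  rewrite preimage_setT in H; rewrite -[LHS]H.
  apply: eq_measure_integral => D mD _; apply/esym.
  apply: product_measure_unique => // C A mC mA.
  transitivity (Q (C `&` B t.+1 @^-1` A)) => //.
  rewrite past_independent//; congr (_ * _)%E.
  by rewrite -[LHS]/(pushforward Q (B t.+1) A) B_law.
rewrite fubini_tonelli1//.
rewrite ge0_integral_distribution//; last by move=> w; exact: integral_ge0.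
exact: measurable_fun_fubini_tonelli_F.
Qed.

End gaussian_noise.

(** * The limit process *)

Section limit_process.
Context {R : realType} (d : measure_display) (T : measurableType d)
  (Q : probability T R) (B W : nat -> {RV Q >-> R}) (s2 : nat -> R).
Hypothesis B_indep : mutually_independent Q (fun t : nat => B t.+1).
Hypothesis B_law : forall t, has_law Q (B t.+1) (normal_prob 0 1).
Hypothesis W0 : forall w, W 0%N w = 0.
Hypothesis WS : forall t w, W t.+1 w = W t w + Num.sqrt (s2 t) * B t.+1 w.
Local Notation N01 := (@normal_prob R 0 1).
Local Notation past := (past B).

Lemma normal_probN (A : set R) : measurable A ->
  N01 ((fun x => - x) @^-1` A) = N01 A.
Proof.
move=> mA; rewrite /normal_prob.
have mpdf : measurable_fun setT (fun x : R => (normal_pdf 0 1 x)%:E).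
  by apply/measurable_EFinP; exact: measurable_normal_pdf.
have mN : measurable_fun setT (fun x : measurableTypeR R => - x : measurableTypeR R).
  exact: measurable_funN.
transitivity (\int[lebesgue_measure]_(x in (fun x => (- x)%R) @^-1` A)
    ((fun y => (normal_pdf 0 1 y)%:E) \o (fun x : R => (- x)%R)) x)%E.
  apply: eq_integral => x _ /=; congr EFin.
  by rewrite !normal_pdfE ?oner_eq0// /normal_fun !subr0 sqrrN.
rewrite -(ge0_integral_pushforward mN lebesgue_measure)//; last 2 first.
- exact: measurable_funTS.
- by move=> x _; rewrite lee_fin normal_pdf_ge0.
by apply: eq_measure_integral => D mD _; exact: lebesgue_measureN.
Qed.

(** The standard Gaussian law is symmetric, so the sign of the coefficient is
    immaterial. *)
Lemma normal_prob_abs (x e : R) (A : set R) : measurable A ->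
  N01 [set y | A (x + e * y)] = N01 [set y | A (x + Num.sqrt (e ^+ 2) * y)].
Proof.
move=> mA; rewrite sqrtr_sqr; have [e0|e0] := ger0P e; first by [].
rewrite -[RHS]normal_probN; last first.
  by rewrite -[X in measurable X]setTI; exact: (measurable_affine x (- e)).
by congr (N01 _); apply/seteqP; split => y /=; rewrite mulrNN.
Qed.

Lemma normal_prob_sum_preimage (v w : R) (A : set R) : 0 <= v -> 0 <= w ->
  measurable A ->
  (\int[N01]_x N01 [set y | A ((0 + Num.sqrt v * x) + Num.sqrt w * y)%R]
   = N01 [set z | A (0 + Num.sqrt (v + w) * z)%R])%E.
Proof.
move=> v0 w0 mA; have := normal_prob_sum 0 v0 w0 mA.
have inA (f : R -> R) : [set y | f y \in A] = [set y | A (f y)].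
  by apply/seteqP; split => y /=; rewrite inE.
by rewrite inA => <-; apply: eq_integral => x _; rewrite inA.
Qed.

Lemma measurable_shift_prob (e : R) (A : set R) : measurable A ->
  measurable_fun setT (fun x : R => N01 [set y | A (x + e * y)]).
Proof.
move=> mA.
have mE : measurable [set p : measurableTypeR R * measurableTypeR R | A (p.1 + e * p.2)].
  rewrite (_ : [set _ | _] =
     (fun p : measurableTypeR R * measurableTypeR R => p.1 + e * p.2) @^-1` A)//.
  rewrite -[X in measurable X]setTI.
  by apply: measurable_funD => //; apply: measurable_funM.
have := measurable_fun_xsection N01 mE.
apply: eq_measurable_fun => x _ /=; congr (N01 _).
apply/seteqP; split => y; rewrite /xsection /=; first by rewrite inE.
by move=> ?; rewrite inE.
Qed.

Lemma measurable_past_W t k : (k <= t)%N -> measurable_fun setT (W k : past t -> R).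
Proof.
elim: k => [|k IH] kt.
  rewrite (_ : (W 0%N : past t -> R) = cst 0); first exact: measurable_cst.
  by apply/funext => w; rewrite W0.
rewrite (_ : (W k.+1 : past t -> R) = fun w => W k w + Num.sqrt (s2 k) * B k.+1 w); last first.
  by apply/funext => w; rewrite WS.
apply: measurable_funD; first exact: IH (ltnW kt).
by apply: measurable_funM => //; exact: measurable_past_noise.
Qed.

Lemma history_past t C : history W t C -> <<s noise_events B t >> C.
Proof.
apply; split; first exact: smallest_sigma_algebra.
move=> _ [k [A [kt mA] ->]].
by have := measurable_past_W kt measurableT mA; rewrite setTI.
Qed.

Lemma freezing_event t (V : past t -> R) (C : set T) (e : R) (A : set R) :
  measurable_fun setT V -> <<s noise_events B t >> C -> measurable A ->
  (Q (C `&` [set w | A (V w + e * B t.+1 w)%R]) =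
   \int[Q]_(w in C) N01 [set y | A (V w + e * y)%R])%E.
Proof.
move=> mV sC mA.
have mC : measurable (C : set (past t)) by [].
have mC' : measurable C.
  apply: sC; split; first exact: sigma_algebra_measurable.
  by move=> _ [k [D [_ mD] ->]]; exact: measurable_noise.
pose E := [set p : past t * measurableTypeR R | C p.1 /\ A (V p.1 + e * p.2)].
have mE : measurable E.
  have -> : E = (C `*` setT) `&`
     (fun p : past t * measurableTypeR R => V p.1 + e * p.2) @^-1` A.
    by apply/seteqP; split => p /= => [[? ?]|[[? _] ?]]; split.
  apply: measurableI; first exact: measurableX.
  rewrite -[X in measurable X]setTI.
  apply: measurable_funD => //.
    by apply: (measurableT_comp mV); exact: measurable_fst.
  by apply: measurable_funM => //; exact: measurable_snd.
have mpsi : measurable_fun setT (EFin \o \1_E : past t * measurableTypeR R -> \bar R).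
  by apply/measurable_EFinP; exact: measurable_indic.
have psi0 p : (0 <= (EFin \o \1_E : past t * measurableTypeR R -> \bar R) p)%E.
  by rewrite lee_fin.
have H := freezing B_indep B_law mpsi psi0.
transitivity (\int[Q]_w (\1_(C `&` [set w | (A (V w + e * B t.+1 w))%R]) w)%:E)%E.
  rewrite integral_indic ?setIT//; apply: measurableI => //.
  have mVT : measurable_fun setT (V : T -> R).
    exact: (measurableT_comp mV (@measurable_to_past _ _ _ _ B t)).
  have mZ : measurable_fun setT (fun w : T => (V : T -> R) w + e * B t.+1 w).
    apply: (@measurable_funD _ T _ setT (V : T -> R)) => //.
    by apply: measurable_funM => //; exact: measurable_funP.
  by rewrite -[X in measurable X]setTI; exact: mZ.
transitivity (\int[Q]_w (\1_E (w : past t, B t.+1 w : measurableTypeR R))%:E)%E.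
  by apply: eq_integral => w _; rewrite !indicE.
rewrite [LHS]H [RHS]integral_mkcond; apply: eq_integral => w _.
rewrite patchE; case: ifPn => [|]; rewrite ?inE ?notin_setE => wC.
  transitivity (\int[N01]_y (\1_[set y | A (V w + e * y)] y)%:E)%E.
    apply: eq_integral => y _ /=; rewrite !indicE; congr ((nat_of_bool _)%:R%:E).
    by apply/idP/idP; rewrite !inE => //= -[].
  rewrite integral_indic ?setIT//.
  by rewrite -[X in measurable X]setTI; exact: (measurable_affine (V w) e).
rewrite (eq_integral (cst 0%E)) ?integral0// => y _ /=.
by rewrite indicE memNset// => -[].
Qed.

(** The transition kernel from [x] is the law of [x + s * y], with [y] standard
    Gaussian and [s ^ 2 = s2 t]. *)
Lemma limit_markov : markov_process Q W.
Proof.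
move=> t A mA; pose s := Num.sqrt (s2 t).
have fin x : N01 [set y | A (x + s * y)] \is a fin_num.
  apply: fin_num_measure.
  by rewrite -[X in measurable X]setTI; exact: (measurable_affine x s).
exists (fun x => fine (N01 [set y | A (x + s * y)])); split.
- apply: (measurableT_comp _ (measurable_shift_prob s mA)).
  exact: fine_measurable.
- move=> x; rewrite fine_ge0 ?measure_ge0//=.
  rewrite -lee_fin fineK// probability_le1//.
  by rewrite -[X in measurable X]setTI; exact: (measurable_affine x s).
- move=> C /history_past sC.
  have := freezing_event s (measurable_past_W (leqnn t)) sC mA.
  under [in RHS]eq_integral do rewrite -[N01 _]fineK//.
  move=> <-; congr (Q _); apply/seteqP; split => w /=; rewrite WS.
    by move=> [? ?].
  by move=> [? ?].
Qed.

(** The first [n] noises are frozen, the last one is integrated out, and the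
    resulting iterated Gaussian integral is a convolution. *)
Lemma noise_comb_law (e : nat -> R) n (A : set R) : measurable A ->
  Q [set w | A (\sum_(j < n) e j * B j.+1 w)] =
  N01 [set z | A (0 + Num.sqrt (\sum_(j < n) e j ^+ 2) * z)].
Proof.
elim: n A => [|n IH] A mA.
  rewrite big_ord0 sqrtr0.
  have [A0|A0] := pselect (A 0).
    rewrite (_ : [set w | _] = setT); last first.
      by apply/seteqP; split => w //= _; rewrite big_ord0.
    rewrite (_ : [set z | _] = setT); last first.
      by apply/seteqP; split => w //= _; rewrite mul0r addr0.
    by rewrite probability_setT; apply/esym; exact: (@probability_setT _ _ _ N01).
  rewrite (_ : [set w | _] = set0); last first.
    by apply/seteqP; split => w //=; rewrite big_ord0.
  rewrite (_ : [set z | _] = set0) ?measure0//.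
  by apply/seteqP; split => w //=; rewrite mul0r addr0.
pose S (w : T) := \sum_(j < n) e j * B j.+1 w.
have mS : measurable_fun setT (S : past n -> R).
  apply: measurable_sum => j; apply: measurable_funM => //.
  exact: measurable_past_noise.
have mST : measurable_fun setT (S : T -> measurableTypeR R).
  exact: (measurableT_comp mS (@measurable_to_past _ _ _ _ B n)).
have sT : <<s noise_events B n >> setT.
  exact: (@measurableT _ (past n)).
have := freezing_event (e n) mS sT mA.
rewrite setTI => H.
transitivity (Q [set w | A (S w + e n * B n.+1 w)]).
  by congr (Q _); apply/seteqP; split => w /=; rewrite big_ord_recr.
rewrite H; under eq_integral do rewrite normal_prob_abs//.
rewrite big_ord_recr/= -(normal_prob_sum_preimage _ (sqr_ge0 (e n)) mA); last first.
  by apply: sumr_ge0 => j _; exact: sqr_ge0.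
pose h (x : measurableTypeR R) := N01 [set y | A (x + Num.sqrt (e n ^+ 2) * y)].
have mh : measurable_fun setT h by exact: measurable_shift_prob.
have h0 x : (0 <= h x)%E by exact: measure_ge0.
set v := \sum_(j < n) _.
have maff := @measurable_affine R 0 (Num.sqrt v).
have H1 := ge0_integral_pushforward mST Q measurableT mh (fun y _ => h0 y).
have H2 := ge0_integral_pushforward maff N01 measurableT mh (fun y _ => h0 y).
rewrite !preimage_setT in H1 H2.
apply: etrans (esym H1) _; apply: etrans _ H2.
by apply: eq_measure_integral => D mD _; exact: IH.
Qed.

Lemma noise_comb_normal (e : nat -> R) n (A : set R) : measurable A ->
  Q [set w | A (\sum_(j < n) e j * B j.+1 w)] =
  normal_law 0 (Num.sqrt (\sum_(j < n) e j ^+ 2)) A.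
Proof.
move=> mA; rewrite (noise_comb_law e n mA) /normal_law.
set s := Num.sqrt _; case: eqVneq => [->|s0].
  rewrite diracE; have [A0|A0] := pselect (A 0).
    rewrite (_ : [set z | _] = setT); last first.
      by apply/seteqP; split => w //= _; rewrite mul0r addr0.
    by rewrite mem_set//; exact: probability_setT.
  rewrite (_ : [set z | _] = set0) ?measure0 ?memNset//.
  by apply/seteqP; split => w //=; rewrite mul0r addr0.
apply: normal_prob_affine => //.
by rewrite lt_neqAle eq_sym s0 sqrtr_ge0.
Qed.

Lemma W_noise t w : W t w = \sum_(j < t) Num.sqrt (s2 j) * B j.+1 w.
Proof.
by elim: t => [|t IH]; rewrite ?big_ord0 ?W0// big_ord_recr/= -IH WS.
Qed.

Lemma comb_W_noise (c : nat -> R) n : exists e : nat -> R, forall w,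
  \sum_(k < n) c k * W k w = \sum_(j < n) e j * B j.+1 w.
Proof.
elim: n => [|n [e IH]]; first by exists (fun=> 0) => w; rewrite !big_ord0.
exists (fun j => if (j < n)%N then e j + c n * Num.sqrt (s2 j) else 0) => w.
rewrite !big_ord_recr/= ltnn mul0r addr0 IH W_noise mulr_sumr -big_split/=.
by apply: eq_bigr => j _; rewrite ltn_ord mulrDl mulrA.
Qed.

Lemma limit_gaussian : gaussian_process Q W.
Proof.
move=> n c; have [e He] := comb_W_noise c n.
exists 0, (Num.sqrt (\sum_(j < n) e j ^+ 2)) => A mA.
rewrite -noise_comb_normal// /pushforward; congr (Q _).
by apply/seteqP; split => w /=; rewrite He.
Qed.

Lemma noise_prod_expectation (g : nat -> R -> R) n : (forall k, test_function (g k)) ->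
  (\int[Q]_w (\prod_(k < n) g k (Num.sqrt (s2 k) * B k.+1 w))%:E =
   (\prod_(k < n) gauss_avg (s2 k) (g k) 0)%:E)%E.
Proof.
move=> tg; elim: n => [|n IH].
  rewrite big_ord0; under eq_integral do rewrite big_ord0.
  by rewrite integral_cst//= probability_setT mule1.
pose S (w : T) := \prod_(k < n) g k (Num.sqrt (s2 k) * B k.+1 w).
have mS : measurable_fun setT (S : past n -> R).
  apply: measurable_prod => k _; apply: (measurableT_comp (tg k).1).
  by apply: measurable_funM => //; exact: measurable_past_noise.
have mST : measurable_fun setT S.
  exact: (measurableT_comp mS (@measurable_to_past _ _ _ _ B n)).
have S0 w : 0 <= S w.
  by apply: prodr_ge0 => k _; case/andP: ((tg k).2 (Num.sqrt (s2 k) * B k.+1 w)).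
pose psi (p : past n * measurableTypeR R) : \bar R :=
  (S p.1 * g n (Num.sqrt (s2 n) * p.2))%:E.
have mpsi : measurable_fun setT psi.
  apply/measurable_EFinP/measurable_funM.
    by apply: (measurableT_comp mS); exact: measurable_fst.
  apply: (measurableT_comp (tg n).1).
  by apply: measurable_funM => //; exact: measurable_snd.
have g0 y : 0 <= g n y by case/andP: ((tg n).2 y).
have psi0 p : (0 <= psi p)%E by rewrite lee_fin mulr_ge0.
transitivity (\int[Q]_w psi (w : past n, B n.+1 w : measurableTypeR R))%E.
  by apply: eq_integral => w _; rewrite big_ord_recr.
rewrite (freezing B_indep B_law mpsi psi0).
transitivity (\int[Q]_w ((S w)%:E * (gauss_avg (s2 n) (g n) 0)%:E))%E.
  apply: eq_integral => w _; rewrite gauss_avgE// -ge0_integralZl//.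
  - by apply: eq_integral => y _; rewrite add0r.
  - apply/measurable_EFinP; exact: (measurable_test_affine 0 _ (tg n).1).
  - by move=> y _; rewrite lee_fin.
  - by rewrite lee_fin.
rewrite ge0_integralZr//; last 3 first.
- exact/measurable_EFinP.
- by move=> w _; rewrite lee_fin.
- by rewrite lee_fin; case/andP: ((gauss_avg_test (s2 n) (tg n)).2 0).
by rewrite IH -EFinM big_ord_recr.
Qed.

(** The Chebyshev argument: [M ^ 2] times the indicator of the tail is at most
    [f ^ 2]. *)
Lemma tail_of_second_moment d1 (T1 : measurableType d1) (P1 : probability T1 R)
    (f : T1 -> R) (M : R) : measurable_fun setT f -> 0 < M ->
  (\int[P1]_w (f w ^+ 2)%:E <= 1)%E ->
  (P1 [set w | (M < `|f w|)%R] <= (M ^- 2)%:E)%E.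
Proof.
move=> mf M0 f2.
have mt : measurable [set w | M < `|f w|].
  have mn : measurable_fun setT (fun w => `|f w|).
    exact: (measurableT_comp (@normr_measurable R setT) mf).
  rewrite (_ : [set _ | _] = setT `&` (fun w => `|f w|) @^-1` `]M, +oo[%classic).
    exact: mn.
  by rewrite setTI; apply/seteqP; split => w /=; rewrite in_itv/= andbT.
have M20 : 0 < M ^+ 2 by rewrite exprn_gt0.
rewrite -(@lee_pmul2l _ (M ^+ 2)%:E)// -EFinM divff ?gt_eqF//.
apply: le_trans f2.
rewrite -(setIT [set w | _]) -integral_indic// -ge0_integralZl//; last 2 first.
- by apply/measurable_EFinP; exact: measurable_indic.
- by rewrite lee_fin ltW.
apply: ge0_le_integral => //.
- by move=> w _; rewrite -EFinM lee_fin mulr_ge0// ltW.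
- by apply/measurable_EFinP/measurable_funM => //; exact: measurable_indic.
- by apply/measurable_EFinP; exact: measurable_funX.
- move=> w _; rewrite -EFinM lee_fin indicE.
  have [wM|wM] := pselect (is_true (M < `|f w|)).
    by rewrite mem_set// mulr1 -[leRHS]real_normK ?num_real// lerXn2r ?nnegrE ?(ltW M0)// ltW.
  by rewrite memNset// mulr0 sqr_ge0.
Qed.

Lemma limit_tails : (forall k, 0 <= s2 k <= 1) ->
  tails_le1 Q (fun k w => Num.sqrt (s2 k) * B k.+1 w).
Proof.
move=> s201 k M M0; have mB' : measurable_fun setT (B k.+1) by exact: measurable_funP.
have mB : measurable_fun setT (B k.+1 : T -> measurableTypeR R) by exact: mB'.
apply: tail_of_second_moment => //; first exact: measurable_funM.
have m2 : measurable_fun setT (fun x : measurableTypeR R => ((x : R) ^+ 2)%:E).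
  by apply/measurable_EFinP; exact: measurable_funX.
have p2 (x : R) : (0 <= (x ^+ 2)%:E)%E by rewrite lee_fin sqr_ge0.
have B2 : (\int[Q]_w ((B k.+1 w) ^+ 2)%:E = 1)%E.
  have H := ge0_integral_pushforward mB Q measurableT m2 (fun y _ => p2 y).
  rewrite preimage_setT in H; apply: etrans (esym H) _.
  transitivity (\int[N01]_x (x ^+ 2)%:E)%E.
    by apply: eq_measure_integral => D mD _; exact: B_law.
  have := @Rintegral_normal_sqr R; rewrite /Rintegral => E.
  rewrite -[LHS]fineK ?E//; apply: integrable_fin_num => //.
  exact: (integrable_expn_normal 1).
have /andP[s0 s1] := s201 k.
under eq_integral do rewrite exprMn sqr_sqrtr// EFinM.
rewrite ge0_integralZl// ?B2 ?mule1 ?lee_fin//.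
by apply/measurable_EFinP; exact: measurable_funX.
Qed.

End limit_process.

(** * Fluctuations as partial sums of increments *)

Section sequence_sums.
Context {R : realType}.
Implicit Types (x : nat -> R).

Definition partial_sums x : nat -> R := fun t => \sum_(k < t) x k.

Lemma partial_sums_continuous :
  continuous (partial_sums : {ptws nat -> R} -> {ptws nat -> R}).
Proof.
move=> x.
apply: (@pointwise_cvgP nat R _ (partial_sums x) (@fmap_filter {ptws nat -> R} (nat -> R) partial_sums
  (nbhs (x : {ptws nat -> R})) (nbhs_filter (x : {ptws nat -> R})))).2 => t.
have H := @cvg_big R 'I_t +%R 0 xpredT (@add_continuous R) {ptws nat -> R}
  (nbhs (x : {ptws nat -> R})) (index_enum 'I_t) (fun k z => z k) (fun k => x k)
  (nbhs_filter (x : {ptws nat -> R})) (fun k _ => @coord_cvg R x k).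
exact: H.
Qed.

End sequence_sums.

Section fluctuation_limit.
Context {R : realType} (a b : nat) (alpha : R).
Hypotheses (a_gt0 : (0 < a)%N) (alpha01 : 0 <= alpha <= 1).
Context (d : measure_display) (T : measurableType d) (P : probability T R)
  (U : nat -> nat -> {RV P >-> R}).
Hypothesis U_indep : mutually_independent P (fun p : nat * nat => U p.1 p.2).
Hypothesis U_uniform : forall t i, has_law P (U t i) (uniform_prob (@ltr01 R)).

Let dr N w t := draws a b alpha N (fun s i => U s i w) t.

(** The latest round is the head of the history, and its tail is the history
    before it. *)
Definition fluctuation_step N t (w : T) : R :=
  increment a b N (head [::] (dr N w t.+1)) (behead (dr N w t.+1)).

Lemma fluctuation_partial_sums N w : (0 < N)%N ->
  (fun t => fluctuation a b alpha U N t w) =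
  partial_sums (fun t => fluctuation_step N t w).
Proof.
move=> N0; apply/funext => t; rewrite /partial_sums.
elim: t => [|t IH].
  rewrite big_ord0 /fluctuation total_fraction_draws /urn_mean/=.
  rewrite (eq_bigr (fun=> a%:R / (a + b)%:R))//.
  by rewrite mean_cst// subrr mulr0.
rewrite big_ord_recr -IH /fluctuation /fluctuation_step /increment.
by rewrite !total_fraction_draws /dr/= -mulrDr; congr (_ * _); ring.
Qed.

Lemma measurable_fluctuation_step N t : measurable_fun setT (fluctuation_step N t).
Proof.
exact: (measurable_draws_fun a b alpha01 U_indep U_uniform N t.+1
  (fun h => increment a b N (head [::] h) (behead h))).
Qed.

Lemma fluctuation_step_tails N : (0 < N)%N -> tails_le1 P (fluctuation_step N).
Proof.
move=> N0 t M M0; apply: tail_of_second_moment => //.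
  exact: measurable_fluctuation_step.
have := expectation_draws a b alpha01 U_indep U_uniform N t.+1
  (fun h => increment a b N (head [::] h) (behead h) ^+ 2).
rewrite unlock /fluctuation_step => ->.
by rewrite lee_fin (increment_sqr_avg b a_gt0 alpha01).
Qed.

Lemma increments_prod_draws (g : nat -> R -> R) N n w :
  increments_prod a b g N (dr N w n) = \prod_(k < n) g k (fluctuation_step N k w).
Proof.
elim: n => [|n IH]; first by rewrite big_ord0.
by rewrite big_ord_recr -IH /fluctuation_step /dr/= size_draws.
Qed.

Lemma fluctuation_step_tests (g : nat -> R -> R) n :
  (forall k, test_function (g k)) -> (forall k, exists C, smooth C (g k)) ->
  \int[P]_w (\prod_(k < n) g k (fluctuation_step N k w)) @[N --> \oo] -->
  \prod_(k < n) gauss_avg (sigma2 a b alpha k) (g k) 0.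
Proof.
move=> tg sg; have [K HK] := increments_prod_avg b a_gt0 alpha01 n tg sg.
have E N : \int[P]_w (\prod_(k < n) g k (fluctuation_step N k w)) =
    hist_avg a b alpha N n (increments_prod a b g N).
  have := expectation_draws a b alpha01 U_indep U_uniform N n (increments_prod a b g N).
  rewrite unlock /Rintegral => EN.
  by under eq_integral do rewrite -increments_prod_draws; rewrite EN.
under eq_fun do rewrite E.
apply/cvgrPdist_le => e e0.
(* For a positive constant, [K' / sqrt N <= e] amounts to
   [(K' / e) ^ 2 <= N]. *)
pose K' := Num.max K 1.
have K'0 : 0 < K' by rewrite lt_max ltr01 orbT.
near=> N.
have N0 : (0 < N)%N by near: N; exact: nbhs_infty_gt.
have NR : 0 < N%:R :> R by rewrite ltr0n.
have r0 : 0 < Num.sqrt N%:R :> R by rewrite sqrtr_gt0.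
rewrite distrC; apply: (le_trans (HK N N0)).
apply: (@le_trans _ _ (K' / Num.sqrt N%:R)).
  by rewrite ler_pM2r ?invr_gt0// le_max lexx.
rewrite ler_pdivrMr// mulrC -ler_pdivrMr//.
apply: (@le_trans _ _ (Num.sqrt ((K' / e) ^+ 2))); first by rewrite sqrtr_sqr ler_norm.
by apply: ler_wsqrtr; near: N; exact: nbhs_infty_ger.
Unshelve. all: by end_near. Qed.

End fluctuation_limit.

Theorem theorem3 (R : realType) (a b : nat) (alpha : R)
    (a_ge1 : (1 <= a)%N) (b_ge1 : (1 <= b)%N) (alpha01 : 0 <= alpha <= 1) :
  (forall t : nat, 0 <= sigma2 a b alpha t) /\
  (forall (d : measure_display) (T : measurableType d) (P : probability T R)
      (U : nat -> nat -> {RV P >-> R})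
      (d' : measure_display) (T' : measurableType d') (Q : probability T' R)
      (B : nat -> {RV Q >-> R}) (W : nat -> {RV Q >-> R}),
    mutually_independent P (fun p : nat * nat => U p.1 p.2) ->
    (forall t i : nat, has_law P (U t i) (uniform_prob (@ltr01 R))) ->
    mutually_independent Q (fun t : nat => B t.+1) ->
    (forall t : nat, has_law Q (B t.+1) (normal_prob 0 1)) ->
    (forall w, W 0%N w = 0) ->
    (forall t w,
       W t.+1 w = W t w + Num.sqrt (sigma2 a b alpha t) * B t.+1 w) ->
    [/\ gaussian_process Q W, markov_process Q W &
        converges_weakly P Q (fun N t => fluctuation a b alpha U N t) W]).
Proof.
have s201 := sigma2_bound b a_ge1 alpha01.
split => [t|]; first by case/andP: (s201 t).
move=> d T P U d' T' Q B W U_indep U_law B_indep B_law W0 WS; split.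
- exact: limit_gaussian B_indep B_law W0 WS.
- exact: limit_markov B_indep B_law W0 WS.
move=> f cf [M [Mr fM]].
have mX N k := measurable_fluctuation_step a b alpha01 U_indep U_law N k.
pose Y k w := Num.sqrt (sigma2 a b alpha k) * B k.+1 w.
have mY k : measurable_fun setT (Y k) by apply: measurable_funM.
(* Convergence is known for the increments; [F] expresses the functional [f] of
   the fluctuations through them. *)
pose F (x : {ptws nat -> R}) := f (partial_sums x).
have cF : continuous F.
  move=> x; exact: (cvg_comp (partial_sums : {ptws nat -> R} -> {ptws nat -> R}) f
    (@partial_sums_continuous R x) (cf _)).
have bF : bounded_fun F.
  by exists M; split => // K MK x _; exact: fM MK _ I.
have XY (g : nat -> R -> R) n : (forall k, test_function (g k)) ->
    (forall k, exists C, smooth C (g k)) ->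
    \int[P]_w (\prod_(k < n) g k (fluctuation_step a b alpha U N k w)) @[N --> \oo]
    --> \int[Q]_w (\prod_(k < n) g k (Y k w)).
  move=> tg sg; rewrite [X in _ --> X](_ : _ =
      \prod_(k < n) gauss_avg (sigma2 a b alpha k) (g k) 0).
    exact: fluctuation_step_tests.
  by rewrite /Rintegral (noise_prod_expectation _ B_indep B_law).
have := product_tests_cvg mX mY
  (fluctuation_step_tails b a_ge1 alpha01 U_indep U_law)
  (limit_tails B_law s201) XY cF bF.
have -> : (fun w => F (fun k => Y k w)) = (fun w => f (fun t => W t w)).
  apply/funext => w; congr (f _); apply/funext => t.
  by rewrite (W_noise W0 WS).
(* The fluctuations start from 0 only if there is at least one urn. *)
apply: cvg_trans; apply: near_eq_cvg; near=> N.
have N0 : (0 < N)%N by near: N; exact: nbhs_infty_gt.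
by congr expectation; apply/funext => w; rewrite fluctuation_partial_sums.
Unshelve. all: by end_near. Qed.
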